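(* Let $F\in \mathrm{D}(\mathbf{k}_{\mathbb{V}_{\mathfrak{a}}})$. Then $F$ is ephemeral (i.e. $F\in\mathrm{D}_{\mathrm{Eph}}(\mathbf{k}_{\mathbb{V}_{\mathfrak{a}}})$) if and only if $\mathrm{Inter}(F,0)=\mathrm{Int}(\gamma^a)$.
   Context: $\mathbf{k}$ is a field and $\mathbb{V}$ is a finite dimensional real vector space. $\gamma\subset\mathbb{V}$ is a closed convex cone ($\mathbb{R}_{>0}\gamma\subset\gamma$) with non-empty interior, and is proper: $\gamma\cap(-\gamma)=\{0\}$. $\gamma^a=-\gamma$, and $\mathrm{Int}$ denotes the interior for the usual topology. $\mathbb{V}_\gamma$ is $\mathbb{V}$ with the $\gamma$-topology: the open sets are the subsets $U$ which are open for the usual topology and satisfy $U+\gamma=U$. $\mathbb{V}_{\mathfrak{a}}$ is $\mathbb{V}$ with the Alexandrov topology: the open sets are all subsets $U$ with $U+\gamma=U$. $\mathrm{Mod}(\mathbf{k}_{X})$ is the category of sheaves of $\mathbf{k}$-modules on $X$ and $\mathrm{D}(\mathbf{k}_X)$ its unbounded derived category. $\beta\colon\mathbb{V}_{\mathfrak{a}}\to\mathbb{V}_\gamma$ is the identity map, which is continuous. A sheaf $G\in\mathrm{Mod}(\mathbf{k}_{\mathbb{V}_{\mathfrak{a}}})$ is ephemeral if $\beta_*G\simeq 0$, i.e. $G(U)=0$ for every $\gamma$-open set $U$. $\mathrm{D}_{\mathrm{Eph}}(\mathbf{k}_{\mathbb{V}_{\mathfrak{a}}})$ is the full subcategory of objects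 $F$ of $\mathrm{D}(\mathbf{k}_{\mathbb{V}_{\mathfrak{a}}})$ such that $\mathrm{H}^i(F)$ is ephemeral for all $i\in\mathbb{Z}$. For $v\in\mathbb{V}$ let $\tau_v\colon x\mapsto x-v$ (a homeomorphism of $\mathbb{V}_{\mathfrak a}$), so that $(\tau_{v*}F)(U)=F(U+v)$ for a sheaf $F$. If $v\in\gamma^a$ then $U\subset U+v$ for every open $U$, and the restriction maps $F(U+v)\to F(U)$ define a natural morphism $\tau_{v*}F\to F$; applying this to a homotopically injective resolution gives, for $F\in\mathrm{D}(\mathbf{k}_{\mathbb{V}_{\mathfrak{a}}})$, a natural morphism $\chi_{v,0}(F)\colon\tau_{v*}F\to F$ in $\mathrm{D}(\mathbf{k}_{\mathbb{V}_{\mathfrak{a}}})$. Objects $F,G$ are $v$-interleaved ($v\in\gamma^a$) if there are morphisms $f\colon\tau_{v*}F\to G$ and $g\colon\tau_{v*}G\to F$ in $\mathrm{D}(\mathbf{k}_{\mathbb{V}_{\mathfrak{a}}})$ with $g\circ\tau_{v*}f=\chi_{2v,0}(F)$ and $f\circ\tau_{v*}g=\chi_{2v,0}(G)$. $\mathrm{Inter}(F,G)=\{v\in\mathrm{Int}(\gamma^a)\mid F\text{ and }G\text{ are }v\text{-interleaved}\}$. *)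

(* Defs.v *)
From HB Require Import structures.
From mathcomp Require Import all_boot all_order all_algebra generic_quotient.
From mathcomp Require Import all_classical all_reals all_analysis.

Set Implicit Arguments.
Unset Strict Implicit.
Unset Printing Implicit Defensive.

Import Order.TTheory GRing.Theory Num.Theory.
Import numFieldNormedType.Exports.

Local Open Scope classical_set_scope.
Local Open Scope ring_scope.
Local Open Scope quotient_scope.

Section LinearAlgebra.
Variable k : fieldType.

Definition mklin (M N : lmodType k) (f : M -> N) (lf : linear f) :
  {linear M -> N} := HB.pack f (GRing.isLinear.Build k M N *:%R f lf).

Lemma linear_ext (M N : lmodType k) (f g : {linear M -> N}) :
  (forall x, f x = g x) -> f = g.
Proof.
case: f g => f [[hf] [kf]] [g [[hg] [kg]]] /= /funext e.
move: hf kf hg kg; rewrite -e => hf kf hg kg.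
by rewrite (Prop_irrelevance hf hg) (Prop_irrelevance kf kg).
Qed.

Section Kernel.
Variables (M N : lmodType k) (f : {linear M -> N}).

Record ker : Type := Ker { ker_val : M; kerP : f ker_val = 0 }.

HB.instance Definition _ := gen_eqMixin ker.
HB.instance Definition _ := gen_choiceMixin ker.

Lemma ker_inj (x y : ker) : ker_val x = ker_val y -> x = y.
Proof. case: x y => x hx [y hy] /= e; subst y.
by rewrite (Prop_irrelevance hx hy). Qed.

Definition ker0 : ker := Ker (linear0 f).

Definition kerD (x y : ker) : ker.
Proof.
by exists (ker_val x + ker_val y); rewrite linearD (kerP x) (kerP y) addr0.
Defined.

Definition kerN (x : ker) : ker.
Proof. by exists (- ker_val x); rewrite linearN (kerP x) oppr0. Defined.

Definition kerZ (a : k) (x : ker) : ker.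
Proof. by exists (a *: ker_val x); rewrite linearZ_LR (kerP x) scaler0. Defined.

Let kerDA : associative kerD.
Proof. by move=> x y z; apply: ker_inj; rewrite /= addrA. Qed.
Let kerDC : commutative kerD.
Proof. by move=> x y; apply: ker_inj; rewrite /= addrC. Qed.
Let kerD0 : left_id ker0 kerD.
Proof. by move=> x; apply: ker_inj; rewrite /= add0r. Qed.
Let kerDN : left_inverse ker0 kerN kerD.
Proof. by move=> x; apply: ker_inj; rewrite /= addNr. Qed.

HB.instance Definition _ := GRing.isZmodule.Build ker kerDA kerDC kerD0 kerDN.

Let kerZA a b (x : ker) : kerZ a (kerZ b x) = kerZ (a * b) x.
Proof. by apply: ker_inj; rewrite /= scalerA. Qed.
Let kerZ1 : left_id 1 kerZ.
Proof. by move=> x; apply: ker_inj; rewrite /= scale1r. Qed.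
Let kerZDr : right_distributive kerZ +%R.
Proof. by move=> a x y; apply: ker_inj; rewrite /= scalerDr. Qed.
Let kerZDl (x : ker) : {morph kerZ^~ x : a b / a + b}.
Proof. by move=> a b; apply: ker_inj; rewrite /= scalerDl. Qed.

HB.instance Definition _ :=
  GRing.Zmodule_isLmodule.Build k ker kerZA kerZ1 kerZDr kerZDl.

End Kernel.

Section KernelLift.
Variables (L M N : lmodType k) (g : {linear L -> M}) (f : {linear M -> N}).
Hypothesis fg : forall x, f (g x) = 0.

Let lift (x : L) : ker f := Ker (fg x).
Let lift_linear : linear lift.
Proof. by move=> a x y; apply: ker_inj; rewrite /= linearP. Qed.

Definition ker_lift : {linear L -> ker f} := mklin lift_linear.

End KernelLift.

Section Cokernel.
Variables (M N : lmodType k) (f : {linear M -> N}).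

Definition coker_rel : rel N := fun x y => `[< exists z, x - y = f z >].

Let coker_refl : reflexive coker_rel.
Proof. by move=> x; apply/asboolP; exists 0; rewrite linear0 subrr. Qed.
Let coker_sym : symmetric coker_rel.
Proof.
by move=> x y; apply/asboolP/asboolP => -[z e]; exists (- z);
   rewrite linearN -e opprB.
Qed.
Let coker_trans : transitive coker_rel.
Proof.
move=> y x z /asboolP[u eu] /asboolP[v ev]; apply/asboolP; exists (u + v).
by rewrite linearD -eu -ev addrA subrK.
Qed.

Canonical coker_equiv := EquivRel coker_rel coker_refl coker_sym coker_trans.

Definition coker : Type := {eq_quot coker_equiv}.

HB.instance Definition _ := Choice.on coker.

Definition coker_cls (x : N) : coker := \pi_{eq_quot coker_equiv} x.

Lemma coker_clsP x y : coker_cls x = coker_cls y <-> exists z, x - y = f z.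
Proof.
split=> [/eqmodP/asboolP//|h]; exact/eqmodP/asboolP.
Qed.

Lemma coker_clsK (c : coker) : coker_cls (repr c) = c.
Proof. exact: reprK. Qed.

Lemma coker_cls_surj (c : coker) : exists x, c = coker_cls x.
Proof. by exists (repr c); rewrite coker_clsK. Qed.

Definition cokerD (c d : coker) : coker := coker_cls (repr c + repr d).
Definition cokerN (c : coker) : coker := coker_cls (- repr c).
Definition cokerZ (a : k) (c : coker) : coker := coker_cls (a *: repr c).

Lemma cokerDE x y : cokerD (coker_cls x) (coker_cls y) = coker_cls (x + y).
Proof.
apply/coker_clsP.
have /coker_clsP[u eu] := coker_clsK (coker_cls x).
have /coker_clsP[v ev] := coker_clsK (coker_cls y).
by exists (u + v); rewrite (linearD f) -eu -ev opprD addrACA.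
Qed.

Lemma cokerNE x : cokerN (coker_cls x) = coker_cls (- x).
Proof.
apply/coker_clsP; have /coker_clsP[u eu] := coker_clsK (coker_cls x).
by exists (- u); rewrite (linearN f) -eu opprD.
Qed.

Lemma cokerZE a x : cokerZ a (coker_cls x) = coker_cls (a *: x).
Proof.
apply/coker_clsP; have /coker_clsP[u eu] := coker_clsK (coker_cls x).
by exists (a *: u); rewrite [RHS]linearZ_LR -eu scalerBr.
Qed.

Let cokerDA : associative cokerD.
Proof.
move=> c d e; case: (coker_cls_surj c) (coker_cls_surj d) (coker_cls_surj e).
by move=> x -> [y ->] [z ->]; rewrite !cokerDE addrA.
Qed.
Let cokerDC : commutative cokerD.
Proof. by move=> c d; rewrite /cokerD addrC. Qed.
Let cokerD0 : left_id (coker_cls 0) cokerD.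
Proof. by move=> c; case: (coker_cls_surj c) => x ->; rewrite cokerDE add0r. Qed.
Let cokerDN : left_inverse (coker_cls 0) cokerN cokerD.
Proof.
by move=> c; case: (coker_cls_surj c) => x ->; rewrite cokerNE cokerDE addNr.
Qed.

HB.instance Definition _ :=
  GRing.isZmodule.Build coker cokerDA cokerDC cokerD0 cokerDN.

Let cokerZA a b (c : coker) : cokerZ a (cokerZ b c) = cokerZ (a * b) c.
Proof. by case: (coker_cls_surj c) => x ->; rewrite !cokerZE scalerA. Qed.
Let cokerZ1 : left_id 1 cokerZ.
Proof. by move=> c; case: (coker_cls_surj c) => x ->; rewrite cokerZE scale1r. Qed.
Let cokerZDr : right_distributive cokerZ +%R.
Proof.
move=> a c d; case: (coker_cls_surj c) (coker_cls_surj d) => x -> [y ->].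
by rewrite [_ + _ in LHS]cokerDE !cokerZE [RHS]cokerDE scalerDr.
Qed.
Let cokerZDl (c : coker) : {morph cokerZ^~ c : a b / a + b}.
Proof.
move=> a b; case: (coker_cls_surj c) => x ->.
by rewrite !cokerZE [RHS]cokerDE scalerDl.
Qed.

HB.instance Definition _ :=
  GRing.Zmodule_isLmodule.Build k coker cokerZA cokerZ1 cokerZDr cokerZDl.

Lemma coker_cls_linear : linear coker_cls.
Proof.
by move=> a x y; rewrite [a *: coker_cls _]cokerZE [RHS]cokerDE.
Qed.

End Cokernel.

Section CokernelMap.
Variables (M N M' N' : lmodType k).
Variables (f : {linear M -> N}) (f' : {linear M' -> N'}).
Variables (u : {linear M -> M'}) (v : {linear N -> N'}).
Hypothesis vf : forall x, v (f x) = f' (u x).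

Let cmap (c : coker f) : coker f' := coker_cls f' (v (repr c)).

Let cmapE x : cmap (coker_cls f x) = coker_cls f' (v x).
Proof.
apply/coker_clsP; have /coker_clsP[z e] := coker_clsK (coker_cls f x).
by exists (u z); rewrite -vf -e linearB.
Qed.

Let cmap_linear : linear cmap.
Proof.
move=> a c d; case: (coker_cls_surj c) (coker_cls_surj d) => x -> [y ->].
by rewrite -coker_cls_linear !cmapE linearP coker_cls_linear.
Qed.

Definition coker_map : {linear coker f -> coker f'} := mklin cmap_linear.

Lemma coker_mapE x : coker_map (coker_cls f x) = coker_cls f' (v x).
Proof. exact: cmapE. Qed.

End CokernelMap.

Section KernelMap.
Variables (M N M' N' : lmodType k).
Variables (f : {linear M -> N}) (f' : {linear M' -> N'}).
Variables (u : {linear M -> M'}) (v : {linear N -> N'}).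
Hypothesis fu : forall x, f' (u x) = v (f x).

Let kmap (x : ker f) : ker f'.
Proof. by exists (u (ker_val x)); rewrite fu (kerP x) linear0. Defined.
Let kmap_linear : linear kmap.
Proof. by move=> a x y; apply: ker_inj; rewrite /= linearP. Qed.

Definition ker_map : {linear ker f -> ker f'} := mklin kmap_linear.

Lemma ker_mapE x : ker_val (ker_map x) = u (ker_val x).
Proof. by []. Qed.

End KernelMap.

End LinearAlgebra.

Record opens (X : topologicalType) :=
  Opens { opens_set :> set X; opens_open : open opens_set }.

Definition opensI (X : topologicalType) (U W : opens X) : opens X :=
  Opens (openI (opens_open U) (opens_open W)).

Lemma opensIl (X : topologicalType) (U W : opens X) : opensI U W `<=` U.
Proof. exact: subIsetl. Qed.

Lemma opensIr (X : topologicalType) (U W : opens X) : opensI U W `<=` W.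
Proof. exact: subIsetr. Qed.

Record presheaf (k : fieldType) (X : topologicalType) := Presheaf {
  sec :> opens X -> lmodType k;
  res : forall U W : opens X, W `<=` U -> {linear sec U -> sec W};
  res_id : forall (U : opens X) (h : U `<=` U) (s : sec U), res h s = s;
  res_comp : forall (U W Z : opens X) (h1 : W `<=` U) (h2 : Z `<=` W)
    (h3 : Z `<=` U) (s : sec U), res h2 (res h1 s) = res h3 s }.

Arguments res {k X} p {U W} h.

Definition separated k X (P : presheaf k X) :=
  forall (I : Type) (U : opens X) (W : I -> opens X)
    (h : forall i, W i `<=` U), U `<=` \bigcup_i W i ->
  forall s t : P U, (forall i, res P (h i) s = res P (h i) t) -> s = t.

Definition gluing k X (P : presheaf k X) :=
  forall (I : Type) (U : opens X) (W : I -> opens X)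
    (h : forall i, W i `<=` U), U `<=` \bigcup_i W i ->
  forall s : forall i, P (W i),
    (forall i j, res P (@opensIl X (W i) (W j)) (s i)
               = res P (@opensIr X (W i) (W j)) (s j)) ->
  exists t : P U, forall i, res P (h i) t = s i.

Record sheaf (k : fieldType) (X : topologicalType) := Sheaf {
  sheaf_pre :> presheaf k X;
  sheaf_sep : separated sheaf_pre;
  sheaf_glue : gluing sheaf_pre }.

Record shom k X (P Q : presheaf k X) := SHom {
  app :> forall U : opens X, {linear P U -> Q U};
  app_res : forall (U W : opens X) (h : W `<=` U) (s : P U),
    app W (res P h s) = res Q h (app U s) }.

Section Hom.
Variables (k : fieldType) (X : topologicalType).
Implicit Types P Q S : presheaf k X.

Lemma shom_ext P Q (f g : shom P Q) : (forall U s, f U s = g U s) -> f = g.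
Proof.
case: f g => f hf [g hg] /= e.
have fg : f = g.
  by apply: functional_extensionality_dep => U; apply: linear_ext => s; exact: e.
by subst g; rewrite (Prop_irrelevance hf hg).
Qed.

Definition shom_id P : shom P P.
Proof. by exists (fun U => idfun). Defined.

Definition shom_comp P Q S (g : shom Q S) (f : shom P Q) : shom P S.
Proof.
by exists (fun U => g U \o f U) => U W h s /=; rewrite !app_res.
Defined.

Definition shom_zero P Q : shom P Q.
Proof. by exists (fun U => \0) => U W h s /=; rewrite linear0. Defined.

Definition is_iso P Q (f : shom P Q) :=
  exists g : shom Q P, shom_comp g f = shom_id P /\ shom_comp f g = shom_id Q.

End Hom.

Section Stalk.
Variables (k : fieldType) (X : topologicalType) (P : presheaf k X) (x : X).

Record local_sec : Type := LocalSec {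
  lsec_dom : opens X;
  lsec_mem : opens_set lsec_dom x;
  lsec_sec : P lsec_dom }.

Definition germ_rel : rel {classic local_sec} := fun a b =>
  `[< exists (W : opens X) (ha : W `<=` lsec_dom a) (hb : W `<=` lsec_dom b),
        opens_set W x /\ res P ha (lsec_sec a) = res P hb (lsec_sec b) >].

Let germ_refl : reflexive germ_rel.
Proof.
move=> a; apply/asboolP; exists (lsec_dom a), (@subset_refl _ _), (@subset_refl _ _).
by split=> //; exact: lsec_mem.
Qed.
Let germ_sym : symmetric germ_rel.
Proof.
by move=> a b; apply/asboolP/asboolP => -[W [h [h' [Wx e]]]]; exists W, h', h.
Qed.
Let germ_trans : transitive germ_rel.
Proof.
move=> b a c /asboolP[W [ha [hb [Wx e]]]] /asboolP[W' [hb' [hc [Wx' e']]]].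
apply/asboolP; exists (opensI W W').
exists (subset_trans (@opensIl _ _ _) ha), (subset_trans (@opensIr _ _ _) hc).
split=> //.
rewrite -(res_comp (U := lsec_dom a) (W := W) ha (@opensIl _ _ _)) e.
rewrite -(res_comp (U := lsec_dom c) (W := W') hc (@opensIr _ _ _)) -e'.
rewrite (res_comp _ _ (subset_trans (@opensIl _ _ _) hb)).
exact/esym/res_comp.
Qed.

Canonical germ_equiv := EquivRel germ_rel germ_refl germ_sym germ_trans.

Definition stalk : Type := {eq_quot germ_equiv}.

HB.instance Definition _ := Choice.on stalk.

Definition germ (U : opens X) (Ux : opens_set U x) (s : P U) : stalk :=
  \pi_{eq_quot germ_equiv} (LocalSec Ux s : {classic local_sec}).

Lemma germP (U W : opens X) (Ux : opens_set U x) (Wx : opens_set W x)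
    (s : P U) (t : P W) :
  germ Ux s = germ Wx t <->
  exists (Z : opens X) (hU : Z `<=` U) (hW : Z `<=` W),
    opens_set Z x /\ res P hU s = res P hW t.
Proof. by split=> [/eqmodP/asboolP//|h]; exact/eqmodP/asboolP. Qed.

Lemma germ_res (U W : opens X) (h : W `<=` U) (Ux : opens_set U x)
    (Wx : opens_set W x) (s : P U) :
  germ Wx (res P h s) = germ Ux s.
Proof.
by apply/germP; exists W, (@subset_refl _ _), h; rewrite res_id.
Qed.

Lemma germ_surj (c : stalk) :
  exists (U : opens X) (Ux : opens_set U x) (s : P U), c = germ Ux s.
Proof.
case e: (repr c : local_sec) => [U Ux s]; exists U, Ux, s.
by rewrite /germ -e reprK.
Qed.

Lemma germ_surj2 (c d : stalk) :
  exists (U : opens X) (Ux : opens_set U x) (s t : P U),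
    c = germ Ux s /\ d = germ Ux t.
Proof.
have [U [Ux [s ->]]] := germ_surj c; have [W [Wx [t ->]]] := germ_surj d.
have UWx : opens_set (opensI U W) x by [].
exists (opensI U W), UWx.
exists (res P (@opensIl _ _ _) s), (res P (@opensIr _ _ _) t).
by rewrite !germ_res.
Qed.

Lemma germ_surj3 (c d e : stalk) :
  exists (U : opens X) (Ux : opens_set U x) (s t u : P U),
    [/\ c = germ Ux s, d = germ Ux t & e = germ Ux u].
Proof.
have [U [Ux [s [t [-> ->]]]]] := germ_surj2 c d.
have [W [Wx [u ->]]] := germ_surj e.
have UWx : opens_set (opensI U W) x by [].
exists (opensI U W), UWx.
exists (res P (@opensIl _ _ _) s), (res P (@opensIl _ _ _) t).
by exists (res P (@opensIr _ _ _) u); rewrite !germ_res.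
Qed.

Definition stalkD (c d : stalk) : stalk :=
  let a : local_sec := repr c in let b : local_sec := repr d in
  germ (U := opensI (lsec_dom a) (lsec_dom b)) (conj (lsec_mem a) (lsec_mem b))
    (res P (@opensIl _ _ _) (lsec_sec a) + res P (@opensIr _ _ _) (lsec_sec b)).
Definition stalkN (c : stalk) : stalk :=
  let a : local_sec := repr c in germ (lsec_mem a) (- lsec_sec a).
Definition stalkZ (r : k) (c : stalk) : stalk :=
  let a : local_sec := repr c in germ (lsec_mem a) (r *: lsec_sec a).
Definition stalk0 : stalk :=
  germ (U := Opens openT) (I : opens_set (Opens openT) x) 0.

Let germ_reprP (c : stalk) :
  germ (lsec_mem (repr c : local_sec)) (lsec_sec (repr c : local_sec)) = c.
Proof.
rewrite /germ -[RHS]reprK; congr (\pi_ _ _).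
by case: (repr c : local_sec).
Qed.

Lemma germD (U : opens X) (Ux : opens_set U x) (s t : P U) :
  stalkD (germ Ux s) (germ Ux t) = germ Ux (s + t).
Proof.
rewrite /stalkD; move: (germ_reprP (germ Ux s)) (germ_reprP (germ Ux t)).
case: (repr (germ Ux s) : local_sec) => A Ax a /=.
case: (repr (germ Ux t) : local_sec) => B Bx b /=.
move=> /germP[W [hA [hU [Wx e]]]] /germP[W' [hB [hU' [Wx' e']]]].
apply/germP; exists (opensI W W').
exists (setISS hA hB), (subset_trans (@opensIl _ _ _) hU); split=> //.
rewrite !linearD /=; congr (_ + _).
  rewrite (res_comp _ _ (subset_trans (@opensIl _ _ _) hA)).
  rewrite -(res_comp hA (@opensIl _ _ _)) e.
  exact: res_comp.
rewrite (res_comp _ _ (subset_trans (@opensIr _ _ _) hB)).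
rewrite -(res_comp hB (@opensIr _ _ _)) e'.
exact: res_comp.
Qed.

Lemma germN (U : opens X) (Ux : opens_set U x) (s : P U) :
  stalkN (germ Ux s) = germ Ux (- s).
Proof.
rewrite /stalkN; move: (germ_reprP (germ Ux s)).
case: (repr (germ Ux s) : local_sec) => A Ax a /= /germP[W [hA [hU [Wx e]]]].
by apply/germP; exists W, hA, hU; rewrite !linearN e.
Qed.

Lemma germZ (U : opens X) (Ux : opens_set U x) r (s : P U) :
  stalkZ r (germ Ux s) = germ Ux (r *: s).
Proof.
rewrite /stalkZ; move: (germ_reprP (germ Ux s)).
case: (repr (germ Ux s) : local_sec) => A Ax a /= /germP[W [hA [hU [Wx e]]]].
by apply/germP; exists W, hA, hU; rewrite !linearZ_LR e.
Qed.

Lemma germ0 (U : opens X) (Ux : opens_set U x) : germ Ux 0 = stalk0.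
Proof.
by apply/germP; exists U, (@subset_refl _ _), (@subsetT _ _); rewrite !linear0.
Qed.

Let stalkDA : associative stalkD.
Proof.
move=> c d e; have [U [Ux [s [t [u [-> -> ->]]]]]] := germ_surj3 c d e.
by rewrite !germD addrA.
Qed.
Let stalkDC : commutative stalkD.
Proof.
move=> c d; have [U [Ux [s [t [-> ->]]]]] := germ_surj2 c d.
by rewrite !germD addrC.
Qed.
Let stalkD0 : left_id stalk0 stalkD.
Proof.
move=> c; have [U [Ux [s ->]]] := germ_surj c.
by rewrite -(germ0 Ux) germD add0r.
Qed.
Let stalkDN : left_inverse stalk0 stalkN stalkD.
Proof.
move=> c; have [U [Ux [s ->]]] := germ_surj c.
by rewrite germN germD addNr germ0.
Qed.

HB.instance Definition _ :=
  GRing.isZmodule.Build stalk stalkDA stalkDC stalkD0 stalkDN.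

Let stalkZA a b (c : stalk) : stalkZ a (stalkZ b c) = stalkZ (a * b) c.
Proof.
by have [U [Ux [s ->]]] := germ_surj c; rewrite !germZ scalerA.
Qed.
Let stalkZ1 : left_id 1 stalkZ.
Proof.
by move=> c; have [U [Ux [s ->]]] := germ_surj c; rewrite germZ scale1r.
Qed.
Let stalkZDr : right_distributive stalkZ +%R.
Proof.
move=> a c d; have [U [Ux [s [t [-> ->]]]]] := germ_surj2 c d.
by rewrite [_ + _ in LHS]germD !germZ [RHS]germD scalerDr.
Qed.
Let stalkZDl (c : stalk) : {morph stalkZ^~ c : a b / a + b}.
Proof.
move=> a b; have [U [Ux [s ->]]] := germ_surj c.
by rewrite !germZ [RHS]germD scalerDl.
Qed.

HB.instance Definition _ :=
  GRing.Zmodule_isLmodule.Build k stalk stalkZA stalkZ1 stalkZDr stalkZDl.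

Lemma germ_linear (U : opens X) (Ux : opens_set U x) : linear (germ Ux).
Proof.
by move=> a s t; rewrite [a *: germ _ _]germZ [RHS]germD.
Qed.

End Stalk.

Section StalkMap.
Variables (k : fieldType) (X : topologicalType) (P Q : presheaf k X).
Variables (f : shom P Q) (x : X).

Definition stalk_map_fun (c : stalk P x) : stalk Q x :=
  let a : local_sec P x := repr c in germ (lsec_mem a) (f _ (lsec_sec a)).

Lemma stalk_map_funE (U : opens X) (Ux : opens_set U x) (s : P U) :
  stalk_map_fun (germ Ux s) = germ Ux (f U s).
Proof.
rewrite /stalk_map_fun.
have : germ (lsec_mem (repr (germ Ux s) : local_sec P x))
    (lsec_sec (repr (germ Ux s) : local_sec P x)) = germ Ux s.
  rewrite /germ -[RHS]reprK; congr (\pi_ _ _).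
  by case: (repr _ : local_sec P x).
case: (repr (germ Ux s) : local_sec P x) => A Ax a /= /germP[W [hA [hU [Wx e]]]].
by apply/germP; exists W, hA, hU; rewrite -!app_res e.
Qed.

Let stalk_map_linear : linear stalk_map_fun.
Proof.
move=> a c d; have [U [Ux [s [t [-> ->]]]]] := germ_surj2 c d.
by rewrite -germ_linear !stalk_map_funE linearP germ_linear.
Qed.

Definition stalk_map : {linear stalk P x -> stalk Q x} := mklin stalk_map_linear.

Lemma stalk_mapE (U : opens X) (Ux : opens_set U x) (s : P U) :
  stalk_map (germ Ux s) = germ Ux (f U s).
Proof. exact: stalk_map_funE. Qed.

End StalkMap.

(* Sections over U of the sheaf associated to P: families of germs of P
   at the points of U that are locally induced by a section of P *)
Section SheafifySections.
Variables (k : fieldType) (X : topologicalType) (P : presheaf k X).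
Variable U : opens X.

Definition locally_germ (s : forall x, opens_set U x -> stalk P x) :=
  forall x, opens_set U x ->
  exists (W : opens X) (h : W `<=` U) (t : P W),
    opens_set W x /\
    forall y (Wy : opens_set W y), s y (h y Wy) = germ Wy t.

Record germ_sec : Type := GermSec {
  gsec_val : forall x, opens_set U x -> stalk P x;
  gsec_loc : locally_germ gsec_val }.

HB.instance Definition _ := gen_eqMixin germ_sec.
HB.instance Definition _ := gen_choiceMixin germ_sec.

Lemma germ_sec_ext (s t : germ_sec) :
  (forall x (Ux : opens_set U x), gsec_val s Ux = gsec_val t Ux) -> s = t.
Proof.
case: s t => s hs [t ht] /= e.
have st : s = t.
  apply: functional_extensionality_dep => x.
  by apply: functional_extensionality_dep => Ux; exact: e.
by subst t; rewrite (Prop_irrelevance hs ht).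
Qed.

Definition gsec0 : germ_sec.
Proof.
exists (fun x _ => 0) => x Ux; exists U, (@subset_refl _ _), 0; split=> // y Uy.
by rewrite germ0.
Defined.

Definition gsecD (s t : germ_sec) : germ_sec.
Proof.
exists (fun x Ux => gsec_val s Ux + gsec_val t Ux) => x Ux.
have [W [h [a [Wx ha]]]] := gsec_loc s Ux.
have [Z [h' [b [Zx hb]]]] := gsec_loc t Ux.
exists (opensI W Z), (subset_trans (@opensIl _ _ _) h).
exists (res P (@opensIl _ _ _) a + res P (@opensIr _ _ _) b); split=> // y WZy.
have [Wy Zy] := WZy; rewrite -[RHS]germD !(germ_res _ _ WZy).
rewrite -ha -hb.
by congr (gsec_val s _ + gsec_val t _); exact: Prop_irrelevance.
Defined.

Definition gsecZ (r : k) (s : germ_sec) : germ_sec.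
Proof.
exists (fun x Ux => r *: gsec_val s Ux) => x Ux.
have [W [h [a [Wx ha]]]] := gsec_loc s Ux.
exists W, h, (r *: a); split=> // y Wy.
by rewrite ha [LHS]germZ.
Defined.

Definition gsecN (s : germ_sec) : germ_sec.
Proof.
exists (fun x Ux => - gsec_val s Ux) => x Ux.
have [W [h [a [Wx ha]]]] := gsec_loc s Ux.
exists W, h, (- a); split=> // y Wy.
by rewrite ha [LHS]germN.
Defined.

Let gsecDA : associative gsecD.
Proof. by move=> s t u; apply: germ_sec_ext => x Ux /=; rewrite addrA. Qed.
Let gsecDC : commutative gsecD.
Proof. by move=> s t; apply: germ_sec_ext => x Ux /=; rewrite addrC. Qed.
Let gsecD0 : left_id gsec0 gsecD.
Proof. by move=> s; apply: germ_sec_ext => x Ux /=; rewrite add0r. Qed.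
Let gsecDN : left_inverse gsec0 gsecN gsecD.
Proof. by move=> s; apply: germ_sec_ext => x Ux /=; rewrite addNr. Qed.

HB.instance Definition _ :=
  GRing.isZmodule.Build germ_sec gsecDA gsecDC gsecD0 gsecDN.

Let gsecZA a b (s : germ_sec) : gsecZ a (gsecZ b s) = gsecZ (a * b) s.
Proof. by apply: germ_sec_ext => x Ux /=; rewrite scalerA. Qed.
Let gsecZ1 : left_id 1 gsecZ.
Proof. by move=> s; apply: germ_sec_ext => x Ux /=; rewrite scale1r. Qed.
Let gsecZDr : right_distributive gsecZ +%R.
Proof. by move=> a s t; apply: germ_sec_ext => x Ux /=; rewrite scalerDr. Qed.
Let gsecZDl (s : germ_sec) : {morph gsecZ^~ s : a b / a + b}.
Proof. by move=> a b; apply: germ_sec_ext => x Ux /=; rewrite scalerDl. Qed.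

HB.instance Definition _ :=
  GRing.Zmodule_isLmodule.Build k germ_sec gsecZA gsecZ1 gsecZDr gsecZDl.

End SheafifySections.

Section Sheafify.
Variables (k : fieldType) (X : topologicalType) (P : presheaf k X).

Definition gsec_res_fun (U W : opens X) (h : W `<=` U) (s : germ_sec P U) :
  germ_sec P W.
Proof.
exists (fun x Wx => gsec_val s (h x Wx)) => x Wx.
have [Z [hZ [t [Zx ht]]]] := gsec_loc s (h x Wx).
exists (opensI W Z), (@opensIl _ _ _), (res P (@opensIr _ _ _) t).
split=> // y WZy; have [Wy Zy] := WZy.
rewrite (germ_res _ Zy) -ht; congr (gsec_val s _); exact: Prop_irrelevance.
Defined.

Let gsec_res_linear (U W : opens X) (h : W `<=` U) : linear (gsec_res_fun h).
Proof. by move=> a s t; apply: germ_sec_ext. Qed.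

Definition sheafify_pre : presheaf k X.
Proof.
apply: (@Presheaf k X (fun U => germ_sec P U : lmodType k)
  (fun U W h => mklin (gsec_res_linear h))).
- move=> U h s; apply: germ_sec_ext => x Ux /=.
  by congr (gsec_val s _); exact: Prop_irrelevance.
- move=> U W Z h1 h2 h3 s; apply: germ_sec_ext => x Zx /=.
  by congr (gsec_val s _); exact: Prop_irrelevance.
Defined.

Lemma sheafify_sep : separated sheafify_pre.
Proof.
move=> I U W h cov s t e; apply: germ_sec_ext => x Ux.
have [i _ Wx] := cov _ Ux; have /(congr1 (@gsec_val _ _ _ _)) := e i.
move=> /(congr1 (fun g => g x Wx)) /=.
by rewrite (Prop_irrelevance (h i x Wx) Ux).
Qed.

Lemma sheafify_glue : gluing sheafify_pre.
Proof.
move=> I U W h cov s comp.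
have idx x : opens_set U x -> {i | opens_set (W i) x}.
  by move=> Ux; apply: cid; have [i _ Wx] := cov _ Ux; exists i.
pose v x (Ux : opens_set U x) := gsec_val (s (sval (idx x Ux))) (svalP (idx x Ux)).
have vE x (Ux : opens_set U x) i (Wx : opens_set (W i) x) :
    v x Ux = gsec_val (s i) Wx.
  rewrite /v; case: (idx x Ux) => j Wjx /=.
  have /= e := congr1 (fun g : germ_sec P (opensI (W i) (W j)) =>
    gsec_val g (conj Wx Wjx : opens_set (opensI _ _) x)) (comp i j).
  rewrite (Prop_irrelevance Wx (@opensIl _ (W i) (W j) x (conj Wx Wjx))) e.
  congr (gsec_val (s j) _); exact: Prop_irrelevance.
have vloc : locally_germ v.
  move=> x Ux; have [i _ Wx] := cov _ Ux.
  have [Z [hZ [t [Zx ht]]]] := gsec_loc (s i) Wx.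
  exists Z, (subset_trans hZ (h i)), t; split=> // y Zy.
  by rewrite (vE _ _ i (hZ y Zy)) ht.
exists (GermSec vloc : sheafify_pre U) => i; apply: germ_sec_ext => x Wx.
exact: vE.
Qed.

Definition sheafify : sheaf k X := Sheaf sheafify_sep sheafify_glue.

End Sheafify.

Section SheafifyMap.
Variables (k : fieldType) (X : topologicalType) (P Q : presheaf k X).
Variable f : shom P Q.

Definition gsec_map_fun (U : opens X) (s : germ_sec P U) : germ_sec Q U.
Proof.
exists (fun x Ux => stalk_map f x (gsec_val s Ux)) => x Ux.
have [W [h [t [Wx ht]]]] := gsec_loc s Ux.
by exists W, h, (f W t); split=> // y Wy; rewrite ht stalk_mapE.
Defined.

Let gsec_map_linear (U : opens X) : linear (@gsec_map_fun U).
Proof.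
by move=> a s t; apply: germ_sec_ext => x Ux; exact: (linearP (stalk_map f x)).
Qed.

Definition sheafify_map : shom (sheafify P) (sheafify Q).
Proof.
apply: (@SHom k X (sheafify P) (sheafify Q)
  (fun U => mklin (@gsec_map_linear U))) => U W h s.
exact: germ_sec_ext.
Defined.

End SheafifyMap.

Section SheafifyIso.
Variables (k : fieldType) (X : topologicalType).

Lemma bij_is_iso (P Q : presheaf k X) (f : shom P Q) :
  (forall U, injective (f U)) -> (forall U t, exists s, f U s = t) -> is_iso f.
Proof.
move=> fI fS.
pose g U t := sval (cid (fS U t)).
have gK U t : f U (g U t) = t by rewrite /g; case: cid.
have gL U : linear (g U).
  by move=> a s t; apply: (fI U); rewrite linearP !gK.
have gR (U W : opens X) (h : W `<=` U) t : g W (res Q h t) = res P h (g U t).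
  by apply: (fI W); rewrite gK app_res gK.
exists (@SHom k X Q P (fun U => mklin (gL U)) gR).
split; apply: shom_ext => U s /=; last exact: gK.
by apply: (fI U); rewrite gK.
Qed.

Definition locally_injective (P Q : presheaf k X) (f : shom P Q) :=
  forall (U : opens X) (s : P U), f U s = 0 ->
  forall x, opens_set U x ->
  exists (W : opens X) (h : W `<=` U), opens_set W x /\ res P h s = 0.

Definition locally_surjective (P Q : presheaf k X) (f : shom P Q) :=
  forall (U : opens X) (t : Q U) x, opens_set U x ->
  exists (W : opens X) (h : W `<=` U) (s : P W),
    opens_set W x /\ f W s = res Q h t.

Definition sheafify_unit_fun (P : presheaf k X) (U : opens X) (s : P U) :
  sheafify P U.
Proof.
exists (fun x Ux => germ Ux s) => x Ux.
exists U, (@subset_refl _ _), s; split=> // y Uy.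
by congr (germ _ s); exact: Prop_irrelevance.
Defined.

Lemma sheafify_isoP (P Q : presheaf k X) (f : shom P Q) :
  is_iso (sheafify_map f) <-> locally_injective f /\ locally_surjective f.
Proof.
split=> [[g [gf fg]]|[fI fS]].
  split=> [U s fs0 x Ux|U t x Ux].
    have e0 : sheafify_map f U (sheafify_unit_fun s) = 0.
      apply: germ_sec_ext => y Uy; rewrite [LHS](stalk_mapE f Uy s) fs0.
      exact: germ0.
    have e1 : sheafify_unit_fun s = 0.
      have := congr1 (fun m : shom _ _ => m U (sheafify_unit_fun s)) gf.
      by rewrite /= [X in g U X]e0 linear0 => <-.
    have /= := congr1 (fun t : germ_sec P U => gsec_val t Ux) e1.
    rewrite -[RHS](germ0 P Ux) => /germP[W [h [h' [Wx e]]]].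
    by exists W, h; rewrite e linear0.
  have := congr1 (fun m : shom _ _ => m U (sheafify_unit_fun t)) fg => /= e.
  have [W [h [s [Wx hs]]]] := gsec_loc (g U (sheafify_unit_fun t)) Ux.
  have := congr1 (fun t : germ_sec Q U => gsec_val t (h x Wx)) e.
  rewrite [LHS]/= hs [LHS](stalk_mapE f Wx s) => /germP[Z [hZ [hZU [Zx e']]]].
  by exists Z, hZU, (res P hZ s); rewrite app_res.
have stI x : injective (stalk_map f x).
  move=> c d e; apply/eqP; rewrite -subr_eq0; apply/eqP.
  have : stalk_map f x (c - d) = 0 by rewrite linearB e subrr.
  have [U [Ux [s ->]]] := germ_surj (c - d).
  rewrite stalk_mapE -[RHS](germ0 Q Ux) => /germP[W [h [h' [Wx e']]]].
  have : f W (res P h s) = 0 by rewrite app_res e' linear0.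
  move=> /fI/(_ x Wx)[Z [hZ [Zx e0]]].
  by rewrite -(germ_res h Ux Wx) -(germ_res hZ Wx Zx) e0; exact: germ0.
have stS x c : exists d, stalk_map f x d = c.
  have [U [Ux [t ->]]] := germ_surj c.
  have [W [h [s [Wx e]]]] := fS U t x Ux.
  by exists (germ Wx s); rewrite stalk_mapE e germ_res.
apply: bij_is_iso => U.
  move=> s t e; apply: germ_sec_ext => x Ux; apply: (stI x).
  exact: (congr1 (fun t : germ_sec Q U => gsec_val t Ux) e).
move=> t; pose v x (Ux : opens_set U x) := sval (cid (stS x (gsec_val t Ux))).
have vK x (Ux : opens_set U x) : stalk_map f x (v x Ux) = gsec_val t Ux.
  by rewrite /v; case: cid.
have vloc : locally_germ v.
  move=> x Ux; have [W [h [t' [Wx ht]]]] := gsec_loc t Ux.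
  have [Z [h' [s [Zx e]]]] := fS W t' x Wx.
  exists Z, (subset_trans h' h), s; split=> // y Zy.
  apply: (stI y); rewrite vK stalk_mapE e (germ_res h' (h' y Zy)) -ht.
  by congr (gsec_val t _); exact: Prop_irrelevance.
exists (GermSec vloc : sheafify P U); apply: germ_sec_ext => x Ux; exact: vK.
Qed.

End SheafifyIso.

(* The differential is given for all pairs of degrees and is required to
   vanish off the pairs (i, i + 1); this avoids casts between i and
   (i - 1) + 1. *)
Record complex (k : fieldType) (X : topologicalType) := Complex {
  obj :> int -> sheaf k X;
  diff : forall i j, shom (obj i) (obj j);
  diff_shape : forall i j, j != i + 1 -> diff i j = shom_zero (obj i) (obj j);
  diff_sq : forall i j l,
    shom_comp (diff j l) (diff i j) = shom_zero (obj i) (obj l) }.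

Record cmap k X (F G : complex k X) := CMap {
  cmap_app :> forall i, shom (F i) (G i);
  cmap_diff : forall i j,
    shom_comp (diff G i j) (cmap_app i) = shom_comp (cmap_app j) (diff F i j) }.

Section Complex.
Variables (k : fieldType) (X : topologicalType).
Implicit Types F G H : complex k X.

Lemma diff_sqE F i j l (U : opens X) (s : F i U) :
  diff F j l U (diff F i j U s) = 0.
Proof. exact: (congr1 (fun m : shom _ _ => m U s) (diff_sq F i j l)). Qed.

Lemma cmap_diffE F G (f : cmap F G) i j (U : opens X) (s : F i U) :
  diff G i j U (f i U s) = f j U (diff F i j U s).
Proof. exact: (congr1 (fun m : shom _ _ => m U s) (cmap_diff f i j)). Qed.

Lemma cmap_ext F G (f g : cmap F G) :
  (forall i U s, f i U s = g i U s) -> f = g.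
Proof.
case: f g => f hf [g hg] /= e.
have fg : f = g.
  by apply: functional_extensionality_dep => i; apply: shom_ext => U s; exact: e.
by subst g; rewrite (Prop_irrelevance hf hg).
Qed.

Definition cmap_id F : cmap F F.
Proof. by exists (fun i => shom_id (F i)) => i j; exact: shom_ext. Defined.

Definition cmap_comp F G H (g : cmap G H) (f : cmap F G) : cmap F H.
Proof.
exists (fun i => shom_comp (g i) (f i)) => i j; apply: shom_ext => U s /=.
by rewrite !cmap_diffE.
Defined.

Definition zero_presheaf : presheaf k X.
Proof.
by apply: (@Presheaf k X (fun=> 'rV[k]_0 : lmodType k) (fun U W h => idfun)).
Defined.

Definition zero_sheaf : sheaf k X.
Proof.
apply: (@Sheaf k X zero_presheaf).
- by move=> I U W h cov s t _; apply/rowP => -[].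
- by move=> I U W h cov s _; exists 0 => i; apply/rowP => -[].
Defined.

Definition zero_complex : complex k X.
Proof.
apply: (@Complex k X (fun=> zero_sheaf)
  (fun i j => shom_zero zero_sheaf zero_sheaf)) => //.
by move=> i j l; exact: shom_ext.
Defined.

Definition coboundary F i (U : opens X) :
    {linear F (i - 1) U -> ker (diff F i (i + 1) U)} :=
  ker_lift (@diff_sqE F (i - 1) i (i + 1) U).

Definition cocycle_res F i (U W : opens X) (h : W `<=` U) :
    {linear ker (diff F i (i + 1) U) -> ker (diff F i (i + 1) W)} :=
  ker_map (app_res (diff F i (i + 1)) h).

Lemma cocycle_resE F i (U W : opens X) (h : W `<=` U) s :
  cocycle_res F i h (coboundary F i U s) = coboundary F i W (res (F (i - 1)) h s).
Proof. by apply: ker_inj; rewrite /= app_res. Qed.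

(* U |-> H^i(F(U)) = ker (d^i) / im (d^(i-1)) *)
Definition coh_pre F (i : int) : presheaf k X.
Proof.
apply: (@Presheaf k X (fun U => coker (coboundary F i U) : lmodType k)
  (fun U W h => coker_map (cocycle_resE (F := F) (i := i) h))).
- move=> U h c; have [s ->] := coker_cls_surj c; rewrite coker_mapE.
  by congr (coker_cls _ _); apply: ker_inj; rewrite /= res_id.
- move=> U W Z h1 h2 h3 c; have [s ->] := coker_cls_surj c.
  rewrite (coker_mapE (cocycle_resE h1)) !coker_mapE.
  by congr (coker_cls _ _); apply: ker_inj; exact: res_comp.
Defined.

(* H^i(F): the cohomology sheaf is the sheaf associated to U |-> H^i(F(U)) *)
Definition coh F (i : int) : sheaf k X := sheafify (coh_pre F i).

Definition cocycle_map F G (f : cmap F G) i (U : opens X) :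
    {linear ker (diff F i (i + 1) U) -> ker (diff G i (i + 1) U)} :=
  ker_map (@cmap_diffE F G f i (i + 1) U).

Lemma cocycle_mapE F G (f : cmap F G) i (U : opens X) s :
  cocycle_map f i U (coboundary F i U s) = coboundary G i U (f (i - 1) U s).
Proof. by apply: ker_inj; rewrite /= cmap_diffE. Qed.

Definition coh_pre_map F G (f : cmap F G) (i : int) :
  shom (coh_pre F i) (coh_pre G i).
Proof.
apply: (@SHom k X (coh_pre F i) (coh_pre G i)
  (fun U => coker_map (@cocycle_mapE F G f i U))) => U W h c.
have [s ->] := coker_cls_surj c.
rewrite (coker_mapE (cocycle_resE h)) (coker_mapE (@cocycle_mapE F G f i U)) !coker_mapE.
by congr (coker_cls _ _); apply: ker_inj; rewrite /= app_res.
Defined.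

Definition coh_map F G (f : cmap F G) (i : int) : shom (coh F i) (coh G i) :=
  sheafify_map (coh_pre_map f i).

Definition qis F G (f : cmap F G) := forall i, is_iso (coh_map f i).

Lemma coh_locally_injectiveP F G (f : cmap F G) i :
  locally_injective (coh_pre_map f i) <->
  forall (U : opens X) (s : F i U), diff F i (i + 1) U s = 0 ->
  forall r, f i U s = diff G (i - 1) i U r ->
  forall x, opens_set U x ->
  exists (W : opens X) (h : W `<=` U) q,
    opens_set W x /\ res (F i) h s = diff F (i - 1) i W q.
Proof.
split=> fI U => [s ds r e x Ux|c e x Ux].
  have : coh_pre_map f i U (coker_cls _ (Ker ds)) = 0.
    rewrite [LHS](coker_mapE (@cocycle_mapE F G f i U)).
    by apply/coker_clsP; exists r; apply: ker_inj; rewrite /= e subr0.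
  move=> /fI/(_ x Ux)[W [h [Wx]]].
  rewrite [LHS](coker_mapE (cocycle_resE h)).
  move=> /coker_clsP[q /(congr1 (@ker_val _ _ _ _))]; rewrite /= subr0 => eq.
  by exists W, h, q.
have [[s ds] ec] := coker_cls_surj c; move: e; rewrite ec.
rewrite [LHS](coker_mapE (@cocycle_mapE F G f i U)).
move=> /coker_clsP[r /(congr1 (@ker_val _ _ _ _))]; rewrite /= subr0 => er.
have [W [h [q [Wx eq]]]] := fI U s ds r er x Ux.
exists W, h; split=> //.
rewrite [LHS](coker_mapE (cocycle_resE h)).
by apply/coker_clsP; exists q; apply: ker_inj; rewrite /= subr0.
Qed.

Lemma coh_locally_surjectiveP F G (f : cmap F G) i :
  locally_surjective (coh_pre_map f i) <->
  forall (U : opens X) (t : G i U), diff G i (i + 1) U t = 0 ->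
  forall x, opens_set U x ->
  exists (W : opens X) (h : W `<=` U) (s : F i W) q,
    [/\ opens_set W x, diff F i (i + 1) W s = 0 &
        f i W s - res (G i) h t = diff G (i - 1) i W q].
Proof.
split=> fS U => [t dt x Ux|c x Ux].
  have [W [h [c [Wx]]]] := fS U (coker_cls _ (Ker dt)) x Ux.
  have [[s ds] ->] := coker_cls_surj c.
  rewrite [LHS](coker_mapE (@cocycle_mapE F G f i W)).
  rewrite [RHS](coker_mapE (cocycle_resE h)).
  move=> /coker_clsP[q /(congr1 (@ker_val _ _ _ _))] /= eq.
  by exists W, h, s, q.
have [[t dt] ->] := coker_cls_surj c.
have [W [h [s [q [Wx ds eq]]]]] := fS U t dt x Ux.
exists W, h, (coker_cls _ (Ker ds)); split=> //.
rewrite [LHS](coker_mapE (@cocycle_mapE F G f i W)).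
rewrite [RHS](coker_mapE (cocycle_resE h)).
by apply/coker_clsP; exists q; exact: ker_inj.
Qed.

End Complex.

(* D(k_X) is the localization of the category of complexes at the
   quasi-isomorphisms.  Its morphisms are words in chain maps and formal
   inverses of quasi-isomorphisms, modulo the relations making it a category,
   making chain maps functorial and making the formal inverses inverses.
   Homotopic chain maps become equal in this localization, so it coincides
   with the localization of the homotopy category. *)
Section Derived.
Variables (k : fieldType) (X : topologicalType).

Inductive zigzag : complex k X -> complex k X -> Type :=
| ZMap F G (f : cmap F G) : zigzag F G
| ZInv F G (s : cmap F G) (hs : qis s) : zigzag G F
| ZComp F G H (b : zigzag G H) (a : zigzag F G) : zigzag F H.

Inductive zeq : forall F G, zigzag F G -> zigzag F G -> Prop :=
| zeq_refl F G (a : zigzag F G) : zeq a a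
| zeq_sym F G (a b : zigzag F G) : zeq a b -> zeq b a
| zeq_trans F G (a b c : zigzag F G) : zeq a b -> zeq b c -> zeq a c
| zeq_cong F G H (b b' : zigzag G H) (a a' : zigzag F G) :
    zeq b b' -> zeq a a' -> zeq (ZComp b a) (ZComp b' a')
| zeq_assoc F G H K (c : zigzag H K) (b : zigzag G H) (a : zigzag F G) :
    zeq (ZComp c (ZComp b a)) (ZComp (ZComp c b) a)
| zeq_idl F G (a : zigzag F G) : zeq (ZComp (ZMap (cmap_id G)) a) a
| zeq_idr F G (a : zigzag F G) : zeq (ZComp a (ZMap (cmap_id F))) a
| zeq_comp F G H (g : cmap G H) (f : cmap F G) :
    zeq (ZComp (ZMap g) (ZMap f)) (ZMap (cmap_comp g f))
| zeq_invl F G (s : cmap F G) (hs : qis s) :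
    zeq (ZComp (ZInv hs) (ZMap s)) (ZMap (cmap_id F))
| zeq_invr F G (s : cmap F G) (hs : qis s) :
    zeq (ZComp (ZMap s) (ZInv hs)) (ZMap (cmap_id G)).

(* Morphisms F -> G in D(k_X): zeq-classes of words *)
Definition dhom F G : Type :=
  {c : zigzag F G -> Prop | exists a, c = zeq a}.

Definition dcls F G (a : zigzag F G) : dhom F G :=
  exist _ (zeq a) (ex_intro _ a erefl).

Lemma dcls_eqP F G (a b : zigzag F G) : dcls a = dcls b <-> zeq a b.
Proof.
split=> [/(congr1 sval) /= -> |ab]; first exact: zeq_refl.
apply: eq_exist; apply/funext => c; apply/propext; split=> h.
  exact: zeq_trans (zeq_sym ab) h.
exact: zeq_trans ab h.
Qed.

Lemma dcls_surj F G (c : dhom F G) : exists a, c = dcls a.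
Proof. by case: c => c [a e]; exists a; exact: eq_exist. Qed.

Definition dcomp F G H (g : dhom G H) (f : dhom F G) : dhom F H.
Proof.
exists (fun w => exists b a, [/\ sval g b, sval f a & zeq (ZComp b a) w]).
have [b ->] := dcls_surj g; have [a ->] := dcls_surj f.
exists (ZComp b a); apply/funext => w; apply/propext; split=> /=.
  move=> [b' [a' [hb ha hw]]]; exact: zeq_trans (zeq_cong hb ha) hw.
by move=> h; exists b, a; split=> //; exact: zeq_refl.
Defined.

Lemma dcompE F G H (b : zigzag G H) (a : zigzag F G) :
  dcomp (dcls b) (dcls a) = dcls (ZComp b a).
Proof.
apply: eq_exist; apply/funext => w; apply/propext; split=> /=.
  move=> [b' [a' [hb ha hw]]]; exact: zeq_trans (zeq_cong hb ha) hw.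
by move=> h; exists b, a; split=> //; exact: zeq_refl.
Qed.

Definition dmap F G (f : cmap F G) : dhom F G := dcls (ZMap f).
Definition dinv F G (s : cmap F G) (hs : qis s) : dhom G F := dcls (ZInv hs).

End Derived.

Section Pushforward.
Variables (k : fieldType) (X Y : topologicalType) (phi : X -> Y).
Hypothesis cphi : continuous phi.

Definition opens_preim (U : opens Y) : opens X :=
  Opens ((continuousP phi).1 cphi U (opens_open U)).

Lemma opens_preim_sub (U W : opens Y) :
  W `<=` U -> opens_preim W `<=` opens_preim U.
Proof. by move=> h x; exact: h. Qed.

Definition push_pre (P : presheaf k X) : presheaf k Y.
Proof.
apply: (@Presheaf k Y (fun U => P (opens_preim U))
  (fun U W h => res P (opens_preim_sub h))).
- by move=> U h s; rewrite res_id.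
- by move=> U W Z h1 h2 h3 s; exact: res_comp.
Defined.

Definition push (F : sheaf k X) : sheaf k Y.
Proof.
apply: (@Sheaf k Y (push_pre F)).
- move=> I U W h cov; apply: (@sheaf_sep _ _ F I (opens_preim U)
    (fun i => opens_preim (W i)) (fun i => opens_preim_sub (h i))).
  by move=> x /cov[i _ Wx]; exists i.
- move=> I U W h cov s comp; apply: (@sheaf_glue _ _ F I (opens_preim U)
    (fun i => opens_preim (W i)) (fun i => opens_preim_sub (h i))).
    by move=> x /cov[i _ Wx]; exists i.
  move=> i j.
  have := comp i j => /(congr1 (res F (U := opens_preim (opensI (W i) (W j)))
    (W := opensI (opens_preim (W i)) (opens_preim (W j))) (@subset_refl _ _))).
  rewrite (res_comp _ _ (@opensIl _ _ _)) => ->; exact: res_comp.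
Defined.

Definition push_hom (P Q : presheaf k X) (f : shom P Q) :
  shom (push_pre P) (push_pre Q).
Proof.
apply: (@SHom k Y (push_pre P) (push_pre Q) (fun U => f (opens_preim U))).
by move=> U W h s; exact: (app_res f (opens_preim_sub h)).
Defined.

Definition push_cx (F : complex k X) : complex k Y.
Proof.
apply: (@Complex k Y (fun i => push (F i)) (fun i j => push_hom (diff F i j))).
- by move=> i j ij; apply: shom_ext => U s /=; rewrite diff_shape.
- by move=> i j l; apply: shom_ext => U s /=; rewrite diff_sqE.
Defined.

Definition push_cmap (F G : complex k X) (f : cmap F G) :
  cmap (push_cx F) (push_cx G).
Proof.
apply: (@CMap k Y (push_cx F) (push_cx G) (fun i => push_hom (f i))).
by move=> i j; apply: shom_ext => U s /=; rewrite cmap_diffE.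
Defined.

End Pushforward.

(* The direct image by a homeomorphism is exact *)
Lemma push_qis (k : fieldType) (X Y : topologicalType)
    (phi : X -> Y) (psi : Y -> X) (cphi : continuous phi) (cpsi : continuous psi) :
  cancel phi psi -> cancel psi phi ->
  forall (F G : complex k X) (f : cmap F G),
    qis f -> qis (push_cmap cphi f).
Proof.
move=> phiK psiK F G f hf i; apply/sheafify_isoP.
have /sheafify_isoP[/coh_locally_injectiveP fI /coh_locally_surjectiveP fS] := hf i.
have sub (U : opens X) : opens_preim cphi (opens_preim cpsi U) `<=` U.
  by move=> x /=; rewrite /preimage /= phiK.
have mem (U : opens Y) y : opens_set U y -> opens_set (opens_preim cphi U) (psi y).
  by rewrite /= /preimage /= psiK.
have sub' (U : opens Y) (W : opens X) :
    W `<=` opens_preim cphi U -> opens_preim cpsi W `<=` U.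
  by move=> h y /h; rewrite /= /preimage /= psiK.
split; [apply/coh_locally_injectiveP|apply/coh_locally_surjectiveP].
  move=> U s ds r e y Uy.
  have [W [h [q [Wx eq]]]] := fI (opens_preim cphi U) s ds r e (psi y) (mem _ _ Uy).
  exists (opens_preim cpsi W), (sub' _ _ h), (res (F (i - 1)) (sub W) q); split=> //.
  rewrite [RHS](app_res (diff F (i - 1) i)) -eq.
  exact: (esym (res_comp h (sub W) (opens_preim_sub (cphi := cphi) (sub' _ _ h)) s)).
move=> U t dt y Uy.
have [W [h [s [q [Wx ds eq]]]]] := fS (opens_preim cphi U) t dt (psi y) (mem _ _ Uy).
exists (opens_preim cpsi W), (sub' _ _ h), (res (F i) (sub W) s).
exists (res (G (i - 1)) (sub W) q); split=> //.
  by rewrite [LHS](app_res (diff F i (i + 1))) ds linear0.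
rewrite [RHS](app_res (diff G (i - 1) i)) -eq linearB /=.
congr (_ - _); first exact: (app_res (f i)).
exact: (esym (res_comp h (sub W) (opens_preim_sub (cphi := cphi) (sub' _ _ h)) t)).
Qed.

Section Cone.
Variables (R : realType) (V : normedModType R).

(* On a finite dimensional space every norm induces the usual topology, so a
   normed module satisfying this condition is a finite dimensional real vector
   space with its usual topology. *)
Definition finite_dimensional :=
  exists (n : nat) (f : {linear V -> 'rV[R]_n}), bijective f.

Record pcone := PCone {
  cone_set :> set V;
  cone_closed : closed cone_set;
  cone_convex : convex_set (cone_set : set (convex_lmodType V));
  cone_scale : forall (t : R) (x : V), 0 < t -> cone_set x -> cone_set (t *: x);
  cone_interior : cone_set° !=set0;
  cone_proper : cone_set `&` [set - x | x in cone_set] = [set 0] }.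

(* Both have V as underlying set; the argument gamma selects the topology
   declared on them below. *)
Definition alexandrov (gamma : pcone) : Type := V.
Definition gamma_space (gamma : pcone) : Type := V.

Variable gamma : pcone.
Local Notation Va := (alexandrov gamma).
Local Notation Vg := (gamma_space gamma).

Definition opp_cone : set V := [set - x | x in (gamma : set V)].

Definition add_cone (U : set V) : set V :=
  [set x + g | x in U & g in (gamma : set V)].

Lemma cone0 : cone_set gamma 0.
Proof.
have : (gamma `&` opp_cone) 0 by rewrite [_ `&` _]cone_proper.
by case.
Qed.

Lemma add_coneP (U : set V) :
  add_cone U = U <-> forall x g, U x -> cone_set gamma g -> U (x + g).
Proof.
split=> [e x g Ux gg|h]; first by rewrite -e; exists x => //; exists g.
apply/seteqP; split=> [_ [x Ux [g gg <-]]|x Ux]; first exact: h.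
by exists x => //; exists 0; [exact: cone0|rewrite addr0].
Qed.

HB.instance Definition _ := Choice.on Va.
HB.instance Definition _ := Choice.on Vg.

Definition alex_open (U : set Va) := add_cone U = U.
Definition gamma_open (U : set Vg) := open (U : set V) /\ add_cone U = U.

Let alex_openT : alex_open setT. Proof. exact/add_coneP. Qed.
Let alex_openI : setI_closed alex_open.
Proof.
move=> A B /add_coneP hA /add_coneP hB; apply/add_coneP => x g [Ax Bx] gg.
by split; [exact: hA|exact: hB].
Qed.
Let alex_open_bigU (I : Type) (f : I -> set Va) :
  (forall i, alex_open (f i)) -> alex_open (\bigcup_i f i).
Proof.
move=> h; apply/add_coneP => x g [i _ fx] gg; exists i => //.
by have /add_coneP := h i; apply.
Qed.

HB.instance Definition _ :=
  isOpenTopological.Build Va alex_openT alex_openI alex_open_bigU.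

Let gamma_openT : gamma_open setT.
Proof. by split; [exact: openT|exact: alex_openT]. Qed.
Let gamma_openI : setI_closed gamma_open.
Proof.
by move=> A B [oA hA] [oB hB]; split; [exact: openI|exact: alex_openI].
Qed.
Let gamma_open_bigU (I : Type) (f : I -> set Vg) :
  (forall i, gamma_open (f i)) -> gamma_open (\bigcup_i f i).
Proof.
move=> h; split; last by apply: alex_open_bigU => i; exact: (h i).2.
by apply: bigcup_open => i _; exact: (h i).1.
Qed.

HB.instance Definition _ :=
  isOpenTopological.Build Vg gamma_openT gamma_openI gamma_open_bigU.

Lemma open_alexE (U : set Va) : open U = alex_open U.
Proof. by []. Qed.

Lemma open_gammaE (U : set Vg) : open U = gamma_open U.
Proof. by []. Qed.

Definition beta (x : Va) : Vg := x.

Lemma beta_continuous : continuous beta.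
Proof. by apply/continuousP => U; rewrite open_gammaE => -[_]. Qed.

Definition tau (v : V) (x : Va) : Va := (x : V) - v.

Lemma tau_continuous (v : V) : continuous (tau v).
Proof.
apply/continuousP => U; rewrite !open_alexE => /add_coneP hU.
apply/add_coneP => x g Ux gg.
by have := hU _ _ Ux gg; rewrite /preimage /= /tau addrAC.
Qed.

Lemma tauK (v : V) : cancel (tau v) (tau (- v)).
Proof. by move=> x; rewrite /tau opprK subrK. Qed.

Lemma tauNK (v : V) : cancel (tau (- v)) (tau v).
Proof. by move=> x; rewrite /tau opprK addrK. Qed.

End Cone.

Arguments beta_continuous {R V} gamma.
Arguments tau_continuous {R V} gamma v.

Section Interleaving.
Variables (R : realType) (V : normedModType R) (k : fieldType).
Variable gamma : pcone V.
Local Notation Va := (alexandrov gamma).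
Implicit Types F G : complex k Va.

Definition ephemeral (G : sheaf k Va) :=
  forall (U : opens (gamma_space gamma)) (s : push (beta_continuous gamma) G U),
    s = 0.

Definition D_Eph F := forall i, ephemeral (coh F i).

Definition taucx (v : V) F : complex k Va := push_cx (tau_continuous gamma v) F.

Definition taucmap (v : V) F G (f : cmap F G) : cmap (taucx v F) (taucx v G) :=
  push_cmap (tau_continuous gamma v) f.

Lemma tau_qis (v : V) F G (f : cmap F G) : qis f -> qis (taucmap v f).
Proof.
move=> hf; exact: (push_qis (tau_continuous gamma v)
  (tau_continuous gamma (- v)) (@tauK _ _ gamma v) (@tauNK _ _ gamma v) hf).
Qed.

Fixpoint tauzz (v : V) F G (a : zigzag F G) : zigzag (taucx v F) (taucx v G) :=
  match a with
  | ZMap _ _ f => ZMap (taucmap v f)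
  | ZInv _ _ s hs => ZInv (tau_qis v hs)
  | ZComp _ _ _ b a => ZComp (tauzz v b) (tauzz v a)
  end.

Lemma tauzz_zeq (v : V) F G (a b : zigzag F G) :
  zeq a b -> zeq (tauzz v a) (tauzz v b).
Proof.
have tid H : taucmap v (cmap_id H) = cmap_id (taucx v H) by exact: cmap_ext.
have tcomp H K L (g : cmap K L) (f : cmap H K) :
    taucmap v (cmap_comp g f) = cmap_comp (taucmap v g) (taucmap v f).
  exact: cmap_ext.
elim=> {F G a b} /=.
- by move=> *; exact: zeq_refl.
- by move=> *; exact: zeq_sym.
- by move=> F G a b c _ h _ h'; exact: zeq_trans h h'.
- by move=> *; exact: zeq_cong.
- by move=> *; exact: zeq_assoc.
- by move=> F G a; rewrite tid; exact: zeq_idl.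
- by move=> F G a; rewrite tid; exact: zeq_idr.
- by move=> F G H g f; rewrite tcomp; exact: zeq_comp.
- by move=> F G s hs; rewrite tid; exact: zeq_invl.
- by move=> F G s hs; rewrite tid; exact: zeq_invr.
Qed.

Definition dtau (v : V) F G (f : dhom F G) : dhom (taucx v F) (taucx v G).
Proof.
exists (fun w => exists2 a, sval f a & zeq (tauzz v a) w).
have [a ->] := dcls_surj f; exists (tauzz v a).
apply/funext => w; apply/propext; split=> /= [[b ab h]|h].
  exact: zeq_trans (tauzz_zeq v ab) h.
by exists a => //; exact: zeq_refl.
Defined.

Lemma dtauE (v : V) F G (a : zigzag F G) : dtau v (dcls a) = dcls (tauzz v a).
Proof.
apply: eq_exist; apply/funext => w; apply/propext; split=> /= [[b ab h]|h].
  exact: zeq_trans (tauzz_zeq v ab) h.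
by exists a => //; exact: zeq_refl.
Qed.

(* The identification of tau_(u+v)* with tau_u* tau_v*: both complexes have
   the same sections up to the equality of the open sets U + (u + v) and
   (U + u) + v, and the restriction between these equal open sets is the
   identity. *)
Section TauAdd.
Variables (u v : V) (F : complex k Va).

Lemma tau_add_sub (U : opens Va) :
  opens_preim (tau_continuous gamma v) (opens_preim (tau_continuous gamma u) U)
    `<=` opens_preim (tau_continuous gamma (u + v)) U.
Proof. by move=> x; rewrite /= /preimage /= /tau opprD addrA addrAC. Qed.

Definition tau_add_cmap : cmap (taucx (u + v) F) (taucx u (taucx v F)).
Proof.
unshelve refine (@CMap k Va (taucx (u + v) F) (taucx u (taucx v F)) (fun i =>
  @SHom k Va (taucx (u + v) F i) (taucx u (taucx v F) i)
    (fun U => res (F i) (@tau_add_sub U)) _) _).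
- move=> U W h s; rewrite [LHS](res_comp _ _ (subset_trans (@tau_add_sub W) (opens_preim_sub h))).
  by rewrite [RHS](res_comp _ _ (subset_trans (@tau_add_sub W) (opens_preim_sub h))).
- by move=> i j; apply: shom_ext => U s /=; rewrite app_res.
Defined.

Definition tau_add : dhom (taucx (u + v) F) (taucx u (taucx v F)) :=
  dmap tau_add_cmap.

End TauAdd.

Section Chi.
Variables (v : V) (hv : opp_cone gamma v).

Lemma chi_sub (U : opens Va) : U `<=` opens_preim (tau_continuous gamma v) U.
Proof.
move=> x Ux; have [g gg <-] := hv.
have := opens_open U; rewrite open_alexE => /add_coneP hU.
by rewrite /= /preimage /= /tau opprK; exact: hU.
Qed.

Definition chi_cmap F : cmap (taucx v F) F.
Proof.
unshelve refine (@CMap k Va (taucx v F) F (fun i =>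
  @SHom k Va (taucx v F i) (F i) (fun U => res (F i) (@chi_sub U)) _) _).
- move=> U W h s; rewrite [LHS](res_comp _ _ (subset_trans h (@chi_sub U))).
  by rewrite [RHS](res_comp _ _ (subset_trans h (@chi_sub U))).
- by move=> i j; apply: shom_ext => U s /=; rewrite app_res.
Defined.

(* The restriction maps are taken on F itself: by chi_resolution this is the
   morphism obtained from any resolution F -> I, since tau_v* is exact. *)
Definition chi F : dhom (taucx v F) F := dmap (chi_cmap F).

Lemma chi_natural F G (f : dhom F G) :
  dcomp (chi G) (dtau v f) = dcomp f (chi F).
Proof.
have nat H K (g : cmap H K) :
    cmap_comp (chi_cmap K) (taucmap v g) = cmap_comp g (chi_cmap H).
  by apply: cmap_ext => i U s /=; rewrite app_res.
have [a ->] := dcls_surj f; rewrite dtauE !dcompE; apply/dcls_eqP.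
elim: {f F G} a => [F G g|F G s hs|F G H b hb a ha] /=.
- apply: zeq_trans (zeq_comp _ _) _; rewrite nat.
  exact: zeq_sym (zeq_comp _ _).
- apply: zeq_trans (zeq_sym (zeq_idl _)) _.
  apply: zeq_trans (zeq_cong (zeq_sym (zeq_invl hs)) (zeq_refl _)) _.
  apply: zeq_trans (zeq_sym (zeq_assoc _ _ _)) _.
  apply: zeq_cong; first exact: zeq_refl.
  apply: zeq_trans (zeq_assoc _ _ _) _.
  apply: zeq_trans (zeq_cong (zeq_trans (zeq_comp _ _) _) (zeq_refl _)) _.
    by rewrite -nat; exact: zeq_sym (zeq_comp _ _).
  apply: zeq_trans (zeq_sym (zeq_assoc _ _ _)) _.
  apply: zeq_trans (zeq_cong (zeq_refl _) (zeq_invr (tau_qis v hs))) _.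
  exact: zeq_idr.
- apply: zeq_trans (zeq_assoc _ _ _) _.
  apply: zeq_trans (zeq_cong hb (zeq_refl _)) _.
  apply: zeq_trans (zeq_sym (zeq_assoc _ _ _)) _.
  apply: zeq_trans (zeq_cong (zeq_refl _) ha) _.
  exact: zeq_assoc.
Qed.

Lemma chi_resolution F I (s : cmap F I) (hs : qis s) :
  chi F = dcomp (dinv hs) (dcomp (chi I) (dtau v (dmap s))).
Proof.
rewrite chi_natural /dinv /chi /dmap !dcompE; apply/dcls_eqP.
apply: zeq_sym; apply: zeq_trans (zeq_assoc _ _ _) _.
apply: zeq_trans (zeq_cong (zeq_invl hs) (zeq_refl _)) _.
exact: zeq_idl.
Qed.

End Chi.

Lemma opp_coneD (v : V) : opp_cone gamma v -> opp_cone gamma (v + v).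
Proof.
move=> [g gg <-]; exists (2%:R *: g); first exact: cone_scale.
by rewrite scaler_nat mulr2n opprD.
Qed.

Definition interleaved (v : V) (hv : opp_cone gamma v) F G :=
  exists (f : dhom (taucx v F) G) (g : dhom (taucx v G) F),
    dcomp (dcomp g (dtau v f)) (tau_add v v F) = chi (opp_coneD hv) F /\
    dcomp (dcomp f (dtau v g)) (tau_add v v G) = chi (opp_coneD hv) G.

Definition Inter F G : set V :=
  [set v | exists hv : (opp_cone gamma)° v, interleaved (interior_subset hv) F G].

End Interleaving.

(* Main.v *)
Require Import Defs.
From HB Require Import structures.
From mathcomp Require Import all_boot all_order all_algebra.
From mathcomp Require Import all_classical all_reals all_analysis.

Set Implicit Arguments.
Unset Strict Implicit.
Unset Printing Implicit Defensive.

Import GRing.Theory Num.Theory.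
Import numFieldNormedType.Exports.
(* Makes diff mean the differential of a complex again, not that of a function. *)
Import Defs.
Local Open Scope classical_set_scope.
Local Open Scope ring_scope.
Local Open Scope quotient_scope.

(** Interleaving with 0 is a vanishing statement: a composite through the zero
    complex vanishes, so F and 0 are v-interleaved exactly when the smoothing
    morphism chi from tau_{2v*} F to F is zero in the derived category.

    If this holds for all v in Int(gamma^a), then chi induces zero on every
    cohomology sheaf (coh_zigzag_zeq makes H^i a functor on the derived
    category, interleaved_zero_coh is the vanishing).  A section s of H^i(F)
    over a gamma-open set U, which is open for the usual topology, is defined
    at x + 2v for some small v in Int(gamma^a).  The neighbourhood of x + 2v
    on which s is represented by a cocycle contains x, and the germ of s at x
    is the image under H^i(chi) of the translated class.  Hence s = 0.

    Conversely a morphism that is zero on cohomology need not be zero in the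
    derived category, so for F ephemeral one argues on complexes.  Let w = 2v.
    For U open in the Alexandrov topology, the interior of U + w is gamma-open
    and lies between U and U + w, because w is interior to gamma^a.  Restricting
    a section over U + w to this interior and taking its germs along beta is a
    chain map from tau_{w*} F to beta^{-1} beta_* F, and its composite with the
    counit beta^{-1} beta_* F -> F is the chain map chi (chi_factors).  The
    middle complex is acyclic.  Indeed beta^{-1} preserves acyclicity
    (pull_acyclic), and beta_* F is acyclic (push_beta_acyclic): a cocycle over
    a gamma-open U has zero class in H^i(F)(U), hence is a coboundary near
    x + u for u small in Int(gamma^a), and that neighbourhood has x in its
    interior.  Finally a chain map that factors through an acyclic complex is
    zero in the derived category (dmap_factor_acyclic). *)

(** * Acyclic complexes in the derived category *)

Section DerivedZero.
Variables (k : fieldType) (X : topologicalType).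
Implicit Types F G H A : complex k X.

Definition zero_cmap F G : cmap F G.
Proof.
exists (fun i => shom_zero (F i) (G i)) => i j.
by apply: shom_ext => U s /=; rewrite linear0.
Defined.

Lemma cmap_to_zero_unique F (f g : cmap F (zero_complex k X)) : f = g.
Proof. by apply: cmap_ext => i U s; apply/rowP => -[]. Qed.

(** Vanishing of all cohomology sheaves, stated on local sections so that it can
    be transported along inverse and direct images without their cohomology. *)
Definition acyclic A := forall i (U : opens X) (s : A i U),
  diff A i (i + 1) U s = 0 -> forall x, opens_set U x ->
  exists (W : opens X) (h : W `<=` U) (q : A (i - 1) W),
    opens_set W x /\ res (A i) h s = diff A (i - 1) i W q.

Lemma acyclic_qis A : acyclic A -> qis (zero_cmap A (zero_complex k X)).
Proof.
move=> acA i; apply/sheafify_isoP; split.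
  by apply/coh_locally_injectiveP => U s ds _ _ x Ux; exact: acA.
apply/coh_locally_surjectiveP => U t _ x Ux.
exists U, (@subset_refl _ _), 0, 0; split=> //; first exact: linear0.
by apply/rowP => -[].
Qed.

Lemma dmap_comp F G H (g : cmap G H) (f : cmap F G) :
  dcomp (dmap g) (dmap f) = dmap (cmap_comp g f).
Proof. by rewrite dcompE; apply/dcls_eqP; exact: zeq_comp. Qed.

(** If A is acyclic then s : A -> 0 is invertible in the derived category, with
    inverse the zero map z : 0 -> A, since s z is the identity of 0.  So the
    identity of A equals z s = 0 and can be inserted between f and g. *)
Lemma dmap_factor_acyclic F A G (f : cmap F A) (g : cmap A G) :
  acyclic A -> dmap (cmap_comp g f) = dmap (zero_cmap F G).
Proof.
move=> /acyclic_qis qA; set s := zero_cmap A _ in qA.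
pose z := zero_cmap (zero_complex k X) A.
have sz : cmap_comp s z = cmap_id _ by exact: cmap_to_zero_unique.
have idA : zeq (ZMap (cmap_id A)) (ZMap (cmap_comp z s)).
  apply: zeq_trans (zeq_sym (zeq_invl qA)) _.
  apply: zeq_trans _ (zeq_comp _ _); apply: zeq_cong (zeq_refl _).
  apply: zeq_trans (zeq_sym (zeq_idr _)) _; rewrite -sz.
  apply: zeq_trans (zeq_cong (zeq_refl _) (zeq_sym (zeq_comp _ _))) _.
  apply: zeq_trans (zeq_assoc _ _ _) _.
  exact: zeq_trans (zeq_cong (zeq_invl qA) (zeq_refl _)) (zeq_idl _).
have -> : zero_cmap F G = cmap_comp g (cmap_comp (cmap_comp z s) f).
  by apply: cmap_ext => i U x /=; rewrite linear0.
apply/dcls_eqP; apply: zeq_trans (zeq_sym (zeq_comp _ _)) _.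
apply: zeq_trans _ (zeq_comp _ _); apply: zeq_cong (zeq_refl _) _.
apply: zeq_trans (zeq_sym (zeq_idl _)) _.
exact: zeq_trans (zeq_cong idA (zeq_refl _)) (zeq_comp _ _).
Qed.

End DerivedZero.

(** * Cohomology as a functor on the derived category *)

Section CohomologyFunctor.
Variables (k : fieldType) (X : topologicalType) (i : int).
Implicit Types F G H : complex k X.

Lemma sheafify_map_comp (P Q S : presheaf k X) (g : shom Q S) (f : shom P Q) :
  sheafify_map (shom_comp g f) = shom_comp (sheafify_map g) (sheafify_map f).
Proof.
apply: shom_ext => U s; apply: germ_sec_ext => x Ux /=.
have [W [Wx [t ->]]] := germ_surj (gsec_val s Ux).
by rewrite !stalk_map_funE.
Qed.

Lemma sheafify_map_id (P : presheaf k X) :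
  sheafify_map (shom_id P) = shom_id (sheafify P).
Proof.
apply: shom_ext => U s; apply: germ_sec_ext => x Ux /=.
have [W [Wx [t ->]]] := germ_surj (gsec_val s Ux).
by rewrite stalk_map_funE.
Qed.

Lemma coh_pre_mapE F G (f : cmap F G) (U : opens X)
    (s : ker (diff F i (i + 1) U)) :
  coh_pre_map f i U (coker_cls (coboundary F i U) s) =
  coker_cls (coboundary G i U) (cocycle_map f i U s).
Proof. exact: (coker_mapE (@cocycle_mapE k X F G f i U)). Qed.

Lemma coh_map_comp F G H (g : cmap G H) (f : cmap F G) :
  coh_map (cmap_comp g f) i = shom_comp (coh_map g i) (coh_map f i).
Proof.
rewrite -sheafify_map_comp; congr sheafify_map; apply: shom_ext => U c.
have [s ->] := coker_cls_surj c.
rewrite [RHS](congr1 (coh_pre_map g i U) (coh_pre_mapE f s)) !coh_pre_mapE.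
by congr (coker_cls _ _); exact: ker_inj.
Qed.

Lemma coh_map_id F : coh_map (cmap_id F) i = shom_id (coh F i).
Proof.
rewrite -sheafify_map_id; congr sheafify_map; apply: shom_ext => U c.
have [s ->] := coker_cls_surj c; rewrite coh_pre_mapE.
by congr (coker_cls _ _); exact: ker_inj.
Qed.

Fixpoint coh_zigzag F G (a : zigzag F G) : shom (coh F i) (coh G i) :=
  match a with
  | ZMap _ _ f => coh_map f i
  | ZInv _ _ s hs => sval (cid (hs i))
  | ZComp _ _ _ b a => shom_comp (coh_zigzag b) (coh_zigzag a)
  end.

Lemma coh_zigzag_zeq F G (a b : zigzag F G) :
  zeq a b -> coh_zigzag a = coh_zigzag b.
Proof.
elim=> {F G a b} //=.
- by move=> F G a b c _ -> _ ->.
- by move=> F G H b b' a a' _ -> _ ->.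
- by move=> *; exact: shom_ext.
- by move=> F G a; rewrite coh_map_id; exact: shom_ext.
- by move=> F G a; rewrite coh_map_id; exact: shom_ext.
- by move=> *; rewrite coh_map_comp.
- by move=> F G s hs; rewrite coh_map_id; case: cid => g [].
- by move=> F G s hs; rewrite coh_map_id; case: cid => g [].
Qed.

End CohomologyFunctor.

(** * Inverse image of a sheaf *)

Section InverseImage.
Variables (k : fieldType) (X Y : topologicalType) (phi : X -> Y).

Section Sections.
Variables (G : presheaf k Y) (U : opens X).

(** A section of the inverse image of G over U is a family of germs of G at the
    points phi x that near each point of U comes from a single section of G.
    This is the sheaf associated to the presheaf sending U to the colimit of the
    G W over the open sets W containing phi U, without naming that colimit. *)
Definition locally_pulled (s : forall x, opens_set U x -> stalk G (phi x)) :=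
  forall x, opens_set U x ->
  exists (N : opens X) (hN : N `<=` U) (W : opens Y)
         (hW : forall y, opens_set N y -> opens_set W (phi y)) (t : G W),
    opens_set N x /\
    forall y (Ny : opens_set N y), s y (hN y Ny) = germ (hW y Ny) t.

Record pull_sec : Type := PullSec {
  psec_val : forall x, opens_set U x -> stalk G (phi x);
  psec_loc : locally_pulled psec_val }.

HB.instance Definition _ := gen_eqMixin pull_sec.
HB.instance Definition _ := gen_choiceMixin pull_sec.

Lemma pull_sec_ext (s t : pull_sec) :
  (forall x (Ux : opens_set U x), psec_val s Ux = psec_val t Ux) -> s = t.
Proof.
case: s t => s hs [t ht] /= e.
have st : s = t.
  apply: functional_extensionality_dep => x.
  by apply: functional_extensionality_dep => Ux; exact: e.
by subst t; rewrite (Prop_irrelevance hs ht).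
Qed.

(** All module operations on families are linear combinations, so this one
    stability property serves for each of them. *)
Lemma locally_pulledP (r : k) s t :
  locally_pulled s -> locally_pulled t ->
  locally_pulled (fun x Ux => r *: s x Ux + t x Ux).
Proof.
move=> hs ht x Ux.
have [N [hN [W [hW [a [Nx ha]]]]]] := hs x Ux.
have [M [hM [Z [hZ [b [Mx hb]]]]]] := ht x Ux.
have hWZ y : opens_set (opensI N M) y -> opens_set (opensI W Z) (phi y).
  by move=> [Ny My]; exact: (conj (hW y Ny) (hZ y My)).
exists (opensI N M), (subset_trans (@opensIl _ _ _) hN), (opensI W Z), hWZ.
exists (r *: res G (@opensIl _ _ _) a + res G (@opensIr _ _ _) b).
split=> // y NMy; have [Ny My] := NMy.
rewrite germ_linear (germ_res _ (hW y Ny)) (germ_res _ (hZ y My)) -ha -hb.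
by congr (_ *: s _ _ + t _ _); exact: Prop_irrelevance.
Qed.

Lemma locally_pulled0 : locally_pulled (fun x _ => 0).
Proof.
move=> x Ux; exists U, (@subset_refl _ _), (Opens openT), (fun _ _ => I), 0.
by split=> // y Uy; rewrite germ0.
Qed.

Lemma locally_pulled_ext s t :
  (forall x Ux, s x Ux = t x Ux) -> locally_pulled s -> locally_pulled t.
Proof.
move=> e hs x /hs[N [hN [W [hW [a [Nx ha]]]]]].
by exists N, hN, W, hW, a; split=> // y Ny; rewrite -e.
Qed.

Definition psec0 : pull_sec := PullSec locally_pulled0.

Definition psecD (s t : pull_sec) : pull_sec.
Proof.
exists (fun x Ux => psec_val s Ux + psec_val t Ux).
apply: locally_pulled_ext (locally_pulledP 1 (psec_loc s) (psec_loc t)) => x Ux.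
by rewrite scale1r.
Defined.

Definition psecZ (r : k) (s : pull_sec) : pull_sec.
Proof.
exists (fun x Ux => r *: psec_val s Ux).
apply: locally_pulled_ext (locally_pulledP r (psec_loc s) locally_pulled0) => x Ux.
by rewrite addr0.
Defined.

Definition psecN (s : pull_sec) : pull_sec.
Proof.
exists (fun x Ux => - psec_val s Ux).
apply: locally_pulled_ext (psec_loc (psecZ (- 1) s)) => x Ux.
by rewrite /= scaleN1r.
Defined.

Let psecDA : associative psecD.
Proof. by move=> s t u; apply: pull_sec_ext => x Ux /=; rewrite addrA. Qed.
Let psecDC : commutative psecD.
Proof. by move=> s t; apply: pull_sec_ext => x Ux /=; rewrite addrC. Qed.
Let psecD0 : left_id psec0 psecD.
Proof. by move=> s; apply: pull_sec_ext => x Ux /=; rewrite add0r. Qed.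
Let psecDN : left_inverse psec0 psecN psecD.
Proof. by move=> s; apply: pull_sec_ext => x Ux /=; rewrite addNr. Qed.

HB.instance Definition _ :=
  GRing.isZmodule.Build pull_sec psecDA psecDC psecD0 psecDN.

Let psecZA a b (s : pull_sec) : psecZ a (psecZ b s) = psecZ (a * b) s.
Proof. by apply: pull_sec_ext => x Ux /=; rewrite scalerA. Qed.
Let psecZ1 : left_id 1 psecZ.
Proof. by move=> s; apply: pull_sec_ext => x Ux /=; rewrite scale1r. Qed.
Let psecZDr : right_distributive psecZ +%R.
Proof. by move=> a s t; apply: pull_sec_ext => x Ux /=; rewrite scalerDr. Qed.
Let psecZDl (s : pull_sec) : {morph psecZ^~ s : a b / a + b}.
Proof. by move=> a b; apply: pull_sec_ext => x Ux /=; rewrite scalerDl. Qed.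

HB.instance Definition _ :=
  GRing.Zmodule_isLmodule.Build k pull_sec psecZA psecZ1 psecZDr psecZDl.

Definition induced_fun (W : opens Y)
    (hW : forall x, opens_set U x -> opens_set W (phi x)) (t : G W) : pull_sec.
Proof.
exists (fun x Ux => germ (hW x Ux) t) => x Ux.
exists U, (@subset_refl _ _), W, hW, t; split=> // y Uy.
by congr (germ _ t); exact: Prop_irrelevance.
Defined.

Let induced_linear (W : opens Y)
  (hW : forall x, opens_set U x -> opens_set W (phi x)) : linear (induced_fun hW).
Proof.
by move=> a s t; apply: pull_sec_ext => x Ux; exact: germ_linear.
Qed.

Definition induced (W : opens Y)
    (hW : forall x, opens_set U x -> opens_set W (phi x)) :
  {linear G W -> pull_sec} := mklin (induced_linear hW).

End Sections.

Section Sheaf.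
Variable G : presheaf k Y.

Definition psec_res_fun (U W : opens X) (h : W `<=` U) (s : pull_sec G U) :
  pull_sec G W.
Proof.
exists (fun x Wx => psec_val s (h x Wx)) => x Wx.
have [N [hN [Z [hZ [t [Nx ht]]]]]] := psec_loc s (h x Wx).
exists (opensI W N), (@opensIl _ _ _), Z.
exists (fun y WNy => hZ y (@opensIr _ W N y WNy)), t.
split=> // y [Wy Ny]; rewrite -ht.
by congr (psec_val s _); exact: Prop_irrelevance.
Defined.

Let psec_res_linear (U W : opens X) (h : W `<=` U) : linear (psec_res_fun h).
Proof. by move=> a s t; apply: pull_sec_ext. Qed.

Definition pull_pre : presheaf k X.
Proof.
apply: (@Presheaf k X (fun U => pull_sec G U : lmodType k)
  (fun U W h => mklin (psec_res_linear h))).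
- move=> U h s; apply: pull_sec_ext => x Ux /=.
  by congr (psec_val s _); exact: Prop_irrelevance.
- move=> U W Z h1 h2 h3 s; apply: pull_sec_ext => x Zx /=.
  by congr (psec_val s _); exact: Prop_irrelevance.
Defined.

Lemma pull_sep : separated pull_pre.
Proof.
move=> I U W h cov s t e; apply: pull_sec_ext => x Ux.
have [i _ Wx] := cov _ Ux; have := congr1 (fun g => psec_val g Wx) (e i).
by rewrite /= (Prop_irrelevance (h i x Wx) Ux).
Qed.

Lemma pull_glue : gluing pull_pre.
Proof.
move=> I U W h cov s compat.
have idx x : opens_set U x -> {i | opens_set (W i) x}.
  by move=> Ux; apply: cid; have [i _ Wx] := cov _ Ux; exists i.
pose v x (Ux : opens_set U x) := psec_val (s (sval (idx x Ux))) (svalP (idx x Ux)).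
have vE x (Ux : opens_set U x) i (Wx : opens_set (W i) x) :
    v x Ux = psec_val (s i) Wx.
  rewrite /v; case: (idx x Ux) => j Wjx /=.
  have /= e := congr1 (fun g : pull_sec G (opensI (W i) (W j)) =>
    psec_val g (conj Wx Wjx : opens_set (opensI _ _) x)) (compat i j).
  rewrite (Prop_irrelevance Wx (@opensIl _ (W i) (W j) x (conj Wx Wjx))) e.
  by congr (psec_val (s j) _); exact: Prop_irrelevance.
have vloc : locally_pulled v.
  move=> x Ux; have [i _ Wx] := cov _ Ux.
  have [N [hN [Z [hZ [t [Nx ht]]]]]] := psec_loc (s i) Wx.
  exists N, (subset_trans hN (h i)), Z, hZ, t; split=> // y Ny.
  by rewrite (vE _ _ i (hN y Ny)) ht.
exists (PullSec vloc : pull_pre U) => i; apply: pull_sec_ext => x Wx.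
exact: vE.
Qed.

Definition pull : sheaf k X := Sheaf pull_sep pull_glue.

End Sheaf.

Section Map.
Variables (G H : presheaf k Y) (f : shom G H).

Definition psec_map_fun (U : opens X) (s : pull_sec G U) : pull_sec H U.
Proof.
exists (fun x Ux => stalk_map f (phi x) (psec_val s Ux)) => x Ux.
have [N [hN [W [hW [t [Nx ht]]]]]] := psec_loc s Ux.
by exists N, hN, W, hW, (f W t); split=> // y Ny; rewrite ht stalk_mapE.
Defined.

Let psec_map_linear (U : opens X) : linear (@psec_map_fun U).
Proof.
by move=> a s t; apply: pull_sec_ext => x Ux; exact: (linearP (stalk_map f _)).
Qed.

Definition pull_hom : shom (pull G) (pull H).
Proof.
apply: (@SHom k X (pull G) (pull H) (fun U => mklin (@psec_map_linear U))).
by move=> U W h s; exact: pull_sec_ext.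
Defined.

Lemma pull_hom_induced (U : opens X) (W : opens Y)
    (hW : forall x, opens_set U x -> opens_set W (phi x)) (t : G W) :
  pull_hom U (induced G hW t) = induced H hW (f W t).
Proof. by apply: pull_sec_ext => x Ux; exact: stalk_mapE. Qed.

End Map.

Definition pull_cx (G : complex k Y) : complex k X.
Proof.
apply: (@Complex k X (fun i => pull (G i)) (fun i j => pull_hom (diff G i j))).
- move=> i j ij; apply: shom_ext => U s; apply: pull_sec_ext => x Ux /=.
  have [W [Wx [t ->]]] := germ_surj (psec_val s Ux).
  by rewrite stalk_map_funE diff_shape // germ0.
- move=> i j l; apply: shom_ext => U s; apply: pull_sec_ext => x Ux /=.
  have [W [Wx [t ->]]] := germ_surj (psec_val s Ux).
  by rewrite !stalk_map_funE diff_sqE germ0.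
Defined.

Lemma induced_res (G : presheaf k Y) (U N : opens X) (W Z : opens Y)
    (hW : forall x, opens_set U x -> opens_set W (phi x))
    (hZ : forall x, opens_set N x -> opens_set Z (phi x))
    (hN : N `<=` U) (hZW : Z `<=` W) (t : G W) :
  res (pull G) hN (induced G hW t) = induced G hZ (res G hZW t).
Proof.
by apply: pull_sec_ext => x Nx /=; rewrite (germ_res hZW (hZW _ (hZ x Nx)));
   congr (germ _ t); exact: Prop_irrelevance.
Qed.

Hypothesis cphi : continuous phi.

(** A section is locally induced by a single section t of G.  The differential
    of t has zero germ at phi x, so t becomes a cocycle on a smaller
    neighbourhood of phi x, where acyclicity of G applies. *)
Lemma pull_acyclic (G : complex k Y) : acyclic G -> acyclic (pull_cx G).
Proof.
move=> acG i U s ds x Ux.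
have [N [hN [W [hW [t [Nx ht]]]]]] := psec_loc s Ux.
have : germ (hW x Nx) (diff G i (i + 1) W t) = 0.
  rewrite -stalk_mapE -ht.
  exact: (congr1 (fun a : pull_sec _ U => psec_val a (hN x Nx)) ds).
rewrite -[RHS](germ0 _ (hW x Nx)) => /germP[Z [hZ [hZ' [Zx]]]].
rewrite linear0 -app_res => dt.
have [Z' [h' [q [Z'x eq]]]] := acG i Z _ dt (phi x) Zx.
pose M := opensI N (opens_preim cphi Z').
have hM y : opens_set M y -> opens_set Z' (phi y) by case.
exists M, (subset_trans (@opensIl _ _ _) hN), (induced _ hM q); split=> //.
rewrite [RHS]pull_hom_induced -eq.
apply: pull_sec_ext => y My; have [Ny _] := My.
rewrite [RHS](germ_res h' (h' _ (hM y My))).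
rewrite [RHS](germ_res hZ (hZ _ (h' _ (hM y My)))).
rewrite (Prop_irrelevance (hZ _ _) (hW y Ny)) -ht.
by congr (psec_val s _); exact: Prop_irrelevance.
Qed.

End InverseImage.

(** * The counit from the inverse image of the direct image *)

Section Counit.
Variables (k : fieldType) (X Y : topologicalType) (phi : X -> Y).
Hypothesis cphi : continuous phi.

Section GermsOfSections.
Variable Q : sheaf k X.

Lemma germ_sep (U : opens X) (s t : Q U) :
  (forall x (Ux : opens_set U x), germ Ux s = germ Ux t) -> s = t.
Proof.
move=> e.
have nb (x : {x | opens_set U x}) : {W : opens X | exists h : W `<=` U,
    opens_set W (sval x) /\ res Q h s = res Q h t}.
  apply: cid; have /germP[W [h [h' [Wx]]]] := e _ (svalP x).
  by rewrite (Prop_irrelevance h' h) => est; exists W, h.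
have h x : sval (nb x) `<=` U by have [] := svalP (nb x).
apply: (@sheaf_sep _ _ Q _ U (fun x => sval (nb x)) h) => [x Ux|x].
  by exists (exist _ x Ux) => //; have [h' []] := svalP (nb (exist _ x Ux)).
by have [h' [_]] := svalP (nb x); rewrite (Prop_irrelevance h' (h x)).
Qed.

(** Sections of a sheaf are locally induced families of germs: the local
    sections inducing the family have equal germs on overlaps, hence agree. *)
Lemma germ_glue (U : opens X) (c : forall x, opens_set U x -> stalk Q x) :
  locally_germ (P := Q) c ->
  exists t : Q U, forall x (Ux : opens_set U x), germ Ux t = c x Ux.
Proof.
move=> cloc.
have nb (x : {x | opens_set U x}) : {Wt : {W : opens X & Q W} |
    exists h : projT1 Wt `<=` U, opens_set (projT1 Wt) (sval x) /\
    forall y (Wy : opens_set (projT1 Wt) y), c y (h y Wy) = germ Wy (projT2 Wt)}.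
  apply: cid; have [W [h [t [Wx ht]]]] := cloc _ (svalP x).
  by exists (existT _ W t), h.
pose W x := projT1 (sval (nb x)); pose s x : Q (W x) := projT2 (sval (nb x)).
have h x : W x `<=` U by have [] := svalP (nb x).
have Wx x : opens_set (W x) (sval x) by have [h' []] := svalP (nb x).
have hs x y (Wy : opens_set (W x) y) : germ Wy (s x) = c y (h x y Wy).
  have [h' [_ <-]] := svalP (nb x).
  by congr (c _ _); exact: Prop_irrelevance.
have germs_agree x x' y (Wy : opens_set (opensI (W x) (W x')) y) :
    germ Wy (res Q (@opensIl _ _ _) (s x)) = germ Wy (res Q (@opensIr _ _ _) (s x')).
  rewrite (germ_res _ Wy.1) (germ_res _ Wy.2) !hs.
  by congr (c _ _); exact: Prop_irrelevance.
have cov : U `<=` \bigcup_x W x.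
  by move=> x Ux; exists (exist _ x Ux) => //; exact: (Wx (exist _ x Ux)).
have compat x x' : res Q (@opensIl _ (W x) (W x')) (s x) =
    res Q (@opensIr _ (W x) (W x')) (s x').
  apply: germ_sep => y Wy; exact: germs_agree.
have [t ht] := @sheaf_glue _ _ Q _ U W h cov s compat.
exists t => x Ux; have [y _ Wyx] := cov x Ux.
rewrite -(germ_res (h y) Ux Wyx) ht hs.
by congr (c _ _); exact: Prop_irrelevance.
Qed.

End GermsOfSections.


Section StalkPush.
Variables (P : presheaf k X) (x : X).
Local Notation pushP := (push_pre cphi P).

Definition stalk_push_fun (c : stalk pushP (phi x)) : stalk P x :=
  let a : local_sec pushP (phi x) := repr c in
  germ (U := opens_preim cphi (lsec_dom a)) (lsec_mem a) (lsec_sec a).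

Lemma stalk_push_funE (W : opens Y) (Wx : opens_set W (phi x)) (s : pushP W) :
  stalk_push_fun (germ Wx s) = germ (U := opens_preim cphi W) Wx s.
Proof.
rewrite /stalk_push_fun.
have : germ (lsec_mem (repr (germ Wx s) : local_sec pushP (phi x)))
    (lsec_sec (repr (germ Wx s) : local_sec pushP (phi x))) = germ Wx s.
  rewrite /germ -[RHS]reprK; congr (\pi_ _ _).
  by case: (repr _ : local_sec pushP (phi x)).
case: (repr (germ Wx s) : local_sec pushP (phi x)) => A Ax a /=.
move=> /germP[Z [hA [hW [Zx e]]]].
apply/germP; exists (opens_preim cphi Z).
by exists (opens_preim_sub hA), (opens_preim_sub hW).
Qed.

Let stalk_push_linear : linear stalk_push_fun.
Proof.
move=> a c d; have [U [Ux [s [t [-> ->]]]]] := germ_surj2 c d.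
by rewrite -germ_linear !stalk_push_funE germ_linear.
Qed.

Definition stalk_push : {linear stalk pushP (phi x) -> stalk P x} :=
  mklin stalk_push_linear.

Lemma stalk_pushE (W : opens Y) (Wx : opens_set W (phi x)) (s : pushP W) :
  stalk_push (germ Wx s) = germ (U := opens_preim cphi W) Wx s.
Proof. exact: stalk_push_funE. Qed.

End StalkPush.

Section CounitSheaf.
Variable Q : sheaf k X.
Local Notation pQ := (pull phi (push cphi Q)).

Lemma counit_loc (U : opens X) (s : pQ U) :
  locally_germ (P := Q)
    (fun x (Ux : opens_set U x) => stalk_push Q x (psec_val s Ux)).
Proof.
move=> x Ux; have [N [hN [W [hW [t [Nx ht]]]]]] := psec_loc s Ux.
have hW' : N `<=` opens_preim cphi W by [].
exists N, hN, (res Q hW' t); split=> // y Ny.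
by rewrite ht stalk_pushE (germ_res hW' (hW y Ny)).
Qed.

Definition counit_fun (U : opens X) (s : pQ U) : Q U :=
  sval (cid (germ_glue (counit_loc s))).

Lemma germ_counit_fun (U : opens X) (s : pQ U) x (Ux : opens_set U x) :
  germ Ux (counit_fun s) = stalk_push Q x (psec_val s Ux).
Proof. by rewrite /counit_fun; case: cid. Qed.

Let counit_linear (U : opens X) : linear (@counit_fun U).
Proof.
move=> a s t; apply: germ_sep => x Ux.
by rewrite germ_linear !germ_counit_fun linearP.
Qed.

Definition counit : shom pQ Q.
Proof.
apply: (@SHom k X pQ Q (fun U => mklin (@counit_linear U))) => U W h s.
apply: germ_sep => x Wx.
by rewrite (germ_res h (h x Wx)) !germ_counit_fun.
Defined.

Lemma germ_counit (U : opens X) (s : pQ U) x (Ux : opens_set U x) :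
  germ Ux (counit U s) = stalk_push Q x (psec_val s Ux).
Proof. exact: germ_counit_fun. Qed.

(** Gluing undoes taking germs.  When U is the whole preimage of W, this is a
    triangle identity of the adjunction between inverse and direct image. *)
Lemma counit_induced (U : opens X) (W : opens Y)
    (hW : U `<=` opens_preim cphi W) (t : Q (opens_preim cphi W)) :
  counit U (induced (push cphi Q) hW t) = res Q hW t.
Proof.
apply: germ_sep => x Ux.
by rewrite germ_counit stalk_pushE (germ_res hW (hW x Ux)).
Qed.

End CounitSheaf.

Definition counit_cx (F : complex k X) : cmap (pull_cx phi (push_cx cphi F)) F.
Proof.
exists (fun i => counit (F i)) => i j; apply: shom_ext => U s.
apply: germ_sep => x Ux; rewrite [RHS]germ_counit.
rewrite -[LHS](stalk_mapE (diff F i j) Ux (counit (F i) U s)) germ_counit /=.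
have [W [Wx [t ->]]] := germ_surj (psec_val s Ux).
by rewrite !(stalk_map_funE, stalk_push_funE).
Defined.

End Counit.

(** * Alexandrov-open sets and small translations *)

Section Cone.
Variables (R : realType) (V : normedModType R) (gamma : pcone V).
Local Notation Va := (alexandrov gamma).
Local Notation Vg := (gamma_space gamma).

Lemma interior_opp_cone_scale (t : R) (v : V) :
  0 < t -> (opp_cone gamma)° v -> (opp_cone gamma)° (t *: v).
Proof.
move=> t0 hv; have cvg : (fun z : V => t^-1 *: z) z @[z --> t *: v] --> v.
  rewrite -[X in _ --> X](scalerK (lt0r_neq0 t0)).
  exact: (cvgZ (cvg_cst _) cvg_id).
have near_tv : \forall z \near t *: v, opp_cone gamma (t^-1 *: z) by exact: cvg hv.
apply: filterS near_tv => z [g gg e]; exists (t *: g).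
  exact: cone_scale.
by rewrite -scalerN e scalerA divff ?scale1r // lt0r_neq0.
Qed.

Lemma interior_opp_cone_nonempty : exists v, (opp_cone gamma)° v.
Proof.
have [u hu] := cone_interior gamma; exists (- u).
have cvg : (fun z : V => - z) z @[z --> - u] --> u.
  by rewrite -[X in _ --> X]opprK; exact: (cvgN cvg_id).
have near_Nu : \forall z \near - u, cone_set gamma (- z) by exact: cvg hu.
by apply: filterS near_Nu => z gz; exists (- z) => //; rewrite opprK.
Qed.

Lemma open_of_gamma_open (U : opens Vg) : open (opens_set U : set V).
Proof. by have := opens_open U; rewrite open_gammaE => -[]. Qed.

Lemma exists_small_shift (W : set V) x :
  open W -> W x -> exists v, (opp_cone gamma)° v /\ W (x + v).
Proof.
move=> oW Wx; have [v hv] := interior_opp_cone_nonempty.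
have cvg : (fun t : R => x + t *: v) t @[t --> 0^'+] --> x.
  rewrite -[X in _ --> X]addr0 -(scale0r v); apply: cvgD; first exact: cvg_cst.
  by apply: cvgZr_tmp; exact: cvg_at_right_filter cvg_id.
have nW : nbhs x W by exact: open_nbhs_nbhs.
have [t [t0 Wt]] := filter_ex (filterI (nbhs_right_gt (0 : R)) (cvg _ nW)).
by exists (t *: v); split=> //; exact: interior_opp_cone_scale.
Qed.

(** Points y near x satisfy x + w - y in gamma^a, that is, y in x + w + gamma. *)
Lemma shift_interior (U : opens Va) (x w : V) :
  (opp_cone gamma)° w -> opens_set U (x + w) -> (opens_set U : set V)° x.
Proof.
move=> hw Uxw.
have cvg : (fun z : V => x + w - z) z @[z --> x] --> w.
  rewrite -[X in _ --> X](addrK x) [w + x]addrC.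
  by apply: cvgB; [exact: cvg_cst|exact: cvg_id].
have near_x : \forall z \near x, opp_cone gamma (x + w - z) by exact: cvg hw.
apply: filterS near_x => z [g gg e].
have -> : z = x + w + g by rewrite -[g]opprK e opprB addrC subrK.
by have := opens_open U; rewrite open_alexE => /add_coneP; apply.
Qed.

Lemma gamma_interior_open (U : opens Va) :
  open ((opens_set U : set V)° : set Vg).
Proof.
rewrite open_gammaE; split; first exact: open_interior.
apply/add_coneP => x g Ux gg.
have cvg : (fun z : V => z - g) z @[z --> x + g] --> x.
  rewrite -[X in _ --> X](addrK g).
  by apply: cvgB; [exact: cvg_id|exact: cvg_cst].
have near_xg : \forall z \near x + g, opens_set U (z - g) by exact: cvg Ux.
apply: filterS near_xg => z Uzg; rewrite -(subrK g z).
by have := opens_open U; rewrite open_alexE => /add_coneP; apply.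
Qed.

Definition gamma_interior (U : opens Va) : opens Vg :=
  Opens (gamma_interior_open U).

Lemma gamma_interior_sub (U : opens Va) :
  opens_preim (beta_continuous gamma) (gamma_interior U) `<=` U.
Proof. by move=> x; exact: interior_subset. Qed.

Lemma gamma_interiorS (U W : opens Va) :
  W `<=` U -> gamma_interior W `<=` gamma_interior U.
Proof. exact: (@interiorS V). Qed.

(** The preimage of U under tau_w is U + w, so the gamma-open set on the right
    is squeezed between U and U + w. *)
Lemma gamma_interior_tau (w : V) (U : opens Va) :
  (opp_cone gamma)° w ->
  U `<=` opens_preim (beta_continuous gamma)
           (gamma_interior (opens_preim (tau_continuous gamma w) U)).
Proof.
by move=> hw x Ux; apply: (shift_interior hw); rewrite /= /preimage /= /tau addrK.
Qed.

End Cone.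

(** * Interleaving with the zero complex *)

Section Interleaving.
Variables (R : realType) (V : normedModType R) (gamma : pcone V) (k : fieldType).
Local Notation Va := (alexandrov gamma).
Local Notation bc := (beta_continuous gamma).
Variable F : complex k Va.

(** A cocycle over the gamma-open set U has zero class in H^i(F)(U), hence is a
    coboundary on an Alexandrov neighbourhood Z of x + v.  When v is interior to
    gamma^a, the usual interior of Z is a gamma-open neighbourhood of x. *)
Lemma push_beta_acyclic : D_Eph F -> acyclic (push_cx bc F).
Proof.
move=> ephF i U s ds x Ux.
have [v [hv Uxv]] := exists_small_shift gamma (open_of_gamma_open U) Ux.
pose c : coh_pre F i (opens_preim bc U) :=
  coker_cls (coboundary F i (opens_preim bc U)) (Ker ds).
have /(congr1 (fun a : germ_sec (coh_pre F i) (opens_preim bc U) =>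
    gsec_val a Uxv)) :=
  ephF i U (sheafify_unit_fun c).
rewrite /= -[RHS](germ0 _ (U := opens_preim bc U) Uxv).
move=> /germP[Z [hZ [hZ' [Zxv]]]]; rewrite linear0 => cZ0.
have hZU : gamma_interior Z `<=` U by move=> y /interior_subset/hZ.
move: cZ0; rewrite [LHS](coker_mapE (cocycle_resE hZ)).
move=> /coker_clsP[q /(congr1 (@ker_val _ _ _ _))]; rewrite /= subr0 => eq.
exists (gamma_interior Z), hZU, (res (F (i - 1)) (@gamma_interior_sub _ _ _ Z) q).
split; first exact: shift_interior hv Zxv.
rewrite [RHS](app_res (diff F (i - 1) i)) -eq.
exact: esym (res_comp hZ (@gamma_interior_sub _ _ _ Z) (opens_preim_sub hZU) s).
Qed.

Section Shift.
Variables (w : V) (hw : (opp_cone gamma)° w).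

Definition shift_germs : cmap (taucx w F) (pull_cx (@beta _ _ gamma) (push_cx bc F)).
Proof.
unshelve refine (@CMap k Va (taucx w F) (pull_cx _ (push_cx bc F)) (fun i =>
  @SHom k Va (taucx w F i) (pull_cx _ (push_cx bc F) i) (fun U =>
    induced (push bc (F i)) (gamma_interior_tau (U := U) hw)
    \o res (F i) (@gamma_interior_sub _ _ gamma _)) _) _).
- move=> U W h s.
  have hW := opens_preim_sub (cphi := tau_continuous gamma w) h.
  have hI := gamma_interiorS hW.
  rewrite [RHS](induced_res (phi := @beta _ _ gamma) _
    (gamma_interior_tau hw) _ hI) /=.
  congr (induced _ _ _).
  have sub := subset_trans (@gamma_interior_sub _ _ gamma _) hW.
  rewrite [LHS](res_comp _ _ sub).
  by rewrite [RHS](res_comp _ _ sub).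
- move=> i j; apply: shom_ext => U s.
  by rewrite [LHS]pull_hom_induced /= app_res.
Defined.

Lemma chi_factors (hw' : opp_cone gamma w) :
  chi_cmap hw' F = cmap_comp (counit_cx bc F) shift_germs.
Proof.
apply: cmap_ext => i U s; rewrite [RHS](counit_induced (cphi := bc)).
exact: esym (res_comp _ _ _ _).
Qed.

Lemma ephemeral_chi_zero (hw' : opp_cone gamma w) :
  D_Eph F -> chi hw' F = dmap (zero_cmap (taucx w F) F).
Proof.
move=> /push_beta_acyclic acF; rewrite /chi chi_factors.
by apply: dmap_factor_acyclic; apply: pull_acyclic => //; exact: beta_continuous.
Qed.

End Shift.

Lemma ephemeral_interleaved_zero (v : V) (hv : (opp_cone gamma)° v) :
  D_Eph F -> interleaved (interior_subset hv) F (zero_complex k Va).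
Proof.
move=> ephF.
have hw : (opp_cone gamma)° (v + v).
  by rewrite -mulr2n -scaler_nat; apply: interior_opp_cone_scale.
exists (dmap (zero_cmap _ _)), (dmap (zero_cmap _ _)).
rewrite /dmap !dtauE -!/(dmap _) !dmap_comp; split.
  rewrite (ephemeral_chi_zero hw) //; congr dmap.
  by apply: cmap_ext => i U s.
by congr dmap; exact: cmap_to_zero_unique.
Qed.

(** Needed because the translate of the zero complex is only isomorphic to the
    zero complex, not convertible to it. *)
Lemma coh_tau_zero v i (U : opens Va) (s : coh (taucx v (zero_complex k Va)) i U) :
  s = 0.
Proof.
apply: germ_sec_ext => x Ux; have [W [Wx [c ->]]] := germ_surj (gsec_val s Ux).
have [z ->] := coker_cls_surj c; rewrite -[RHS](germ0 _ Wx); congr germ.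
by apply/coker_clsP; exists 0; apply: ker_inj; apply/rowP => -[].
Qed.

Lemma interleaved_zero_coh (v : V) (hv : opp_cone gamma v) i (U : opens Va)
    (s : coh (taucx (v + v) F) i U) :
  interleaved hv F (zero_complex k Va) ->
  coh_map (chi_cmap (opp_coneD hv) F) i U s = 0.
Proof.
move=> [f [g [+ _]]]; have [a ->] := dcls_surj f; have [b ->] := dcls_surj g.
rewrite dtauE !dcompE => /dcls_eqP/(coh_zigzag_zeq i) e.
rewrite -[LHS](congr1 (fun m : shom _ _ => m U s) e) /=.
by rewrite [X in coh_zigzag i b U X]coh_tau_zero linear0.
Qed.

(** A section s of H^i(F) over a gamma-open U is defined at x + 2v for some
    v in Int(gamma^a).  Near x + 2v it is the class of a cocycle on some Z;
    translating this cocycle by 2v gives a class near x whose image under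
    H^i(chi) is the germ of s at x. *)
Lemma interleaved_zero_D_Eph :
  (forall v (hv : (opp_cone gamma)° v),
     interleaved (interior_subset hv) F (zero_complex k Va)) -> D_Eph F.
Proof.
move=> itl i U s; apply: germ_sec_ext => x Ux.
have [w [hw Uxw]] := exists_small_shift gamma (open_of_gamma_open U) Ux.
have [v [hv vw]] : exists v, (opp_cone gamma)° v /\ v + v = w.
  exists (2^-1 *: w); split; first exact: interior_opp_cone_scale.
  by rewrite -scalerDl -[2^-1]mul1r -splitr scale1r.
have [Z [hZ [c [Zxw hc]]]] := gsec_loc s (x := x + w) Uxw.
have Zx : opens_set Z x by exact: interior_subset (shift_interior hw Zxw).
have -> : gsec_val s Ux = germ Zx c.
  by rewrite -hc; congr (gsec_val s _); exact: Prop_irrelevance.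
pose Z' := opens_preim (tau_continuous gamma (- (v + v))) Z.
have Z'x : opens_set Z' x by rewrite /= /preimage /= /tau opprK vw.
(* Z' is Z translated so that tau_{2v*} F over Z' is F over Z, up to the
   equality of open sets that this inclusion handles. *)
have sub : opens_preim (tau_continuous gamma (v + v)) Z' `<=` Z.
  by move=> y; rewrite /= /preimage /= tauK.
have [z cz] := coker_cls_surj c.
have du : diff (taucx (v + v) F) i (i + 1) Z' (res (F i) sub (ker_val z)) = 0.
  by rewrite [LHS](app_res (diff F i (i + 1)) sub) (kerP z) linear0.
pose c' : coh_pre (taucx (v + v) F) i Z' :=
  coker_cls (coboundary (taucx (v + v) F) i Z') (Ker du).
have /(congr1 (fun a : germ_sec (coh_pre F i) Z' => gsec_val a Z'x)) :=
  interleaved_zero_coh (sheafify_unit_fun c') (itl v hv).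
rewrite [LHS](stalk_mapE _ Z'x c') => c'0.
have hZ' : Z' `<=` Z.
  exact: subset_trans (@chi_sub _ _ _ _ (opp_coneD (interior_subset hv)) Z') sub.
rewrite -(germ_res hZ' Zx Z'x) cz -[RHS]c'0; congr germ.
rewrite coh_pre_mapE [LHS](coker_mapE (cocycle_resE hZ')).
by congr (coker_cls _ _); apply: ker_inj; exact: esym (res_comp _ _ _ _).
Qed.

End Interleaving.


Theorem corollary4p16 (R : realType) (V : normedModType R)
    (finV : finite_dimensional V) (gamma : pcone V) (k : fieldType)
    (F : complex k (alexandrov gamma)) :
  D_Eph F <->
  Inter F (zero_complex k (alexandrov gamma)) = (opp_cone gamma)°.
Proof.
split=> [ephF|e].
  apply/seteqP; split=> [v [hv _] //|v hv].
  by exists hv; exact: ephemeral_interleaved_zero.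
apply: interleaved_zero_D_Eph => v hv.
have [hv' itl] : Inter F (zero_complex k (alexandrov gamma)) v by rewrite e.
by rewrite (Prop_irrelevance hv hv').
Qed.
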